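(* Let $G=\langle a,b,c,d\rangle$ be the Grigorchuk group acting on the binary tree. Let $p=\pi(adad)$, $q=\pi(ad)$, $r=\pi(a)$, $\Omega=\{Zp,Zq,Zr: Z\in\{\Delta,\pi\}^*\}$, with rank defined by $\mathrm{rank}\,p=1$, $\mathrm{rank}\,q=2$, $\mathrm{rank}\,r=3$, $\mathrm{rank}(\pi w)=2\,\mathrm{rank}\,w$, $\mathrm{rank}(\Delta w)=2\,\mathrm{rank}\,w-1$. Then for all $i\in\mathbb N$, \[\mathrm{Aut}^i(G)=\langle a,b,c,d,\ w\in\Omega\text{ with }\mathrm{rank}\,w\le i\rangle.\] In particular $\mathrm{Aut}^{3\cdot2^{n-1}}(G)$ contains $v*G$ for all $v\in X^n$, since $\mathrm{rank}(\pi^na)=3\cdot2^{n-1}$. For all $i\in\mathbb N$, $\mathrm{Out}(\mathrm{Aut}^i(G))\cong(\mathbb Z/2)^\omega$, generated by the elements of $\Omega$ of rank $i+1$. Finally $\mathrm{Aut}^\alpha(G)=\langle\Omega\rangle=G_*$ for all $\alpha\ge\omega$.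
   Context: $W$ is the isometry group of the binary tree $X^*$, $X=\{0,1\}$; elements are written $(g_0,g_1)\pi$, meaning $(yw)^{(g_0,g_1)\pi}=y^\pi w^{g_y}$. $a=(1,1)\sigma$ with $\sigma$ the transposition, and recursively $b=(a,c)$, $c=(a,d)$, $d=(1,b)$. For $g\in W$: $\Delta g=(g,g)$, $\pi g=(1,g)$; for a word $Z=Z_1\cdots Z_k$ over $\{\Delta,\pi\}$, $Zw=Z_1(\cdots Z_k(w))$. For $v\in X^*$, $v*g$ acts as $g$ on the subtree below $v$ and fixes other vertices; $G_*=\langle v*G:v\in X^*\rangle$ is the layered closure of $G$. The automorphism tower $\mathrm{Aut}^\alpha(G)$ is realized inside $W$ as the normalizer tower (automorphisms acting by conjugation). $(\mathbb Z/2)^\omega$ denotes a countably infinite elementary abelian $2$-group.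
   Formalization: ⟨Ω⟩ fixes the first level, so it lacks a and cannot equal G_*; the formal statement uses ⟨a,b,c,d,Ω⟩ instead. ''For all α≥ω'' is stated as Aut^ω(G)=G_* (union of the finite stages) being its own normalizer, whence constancy by transfinite induction. *)

(* Defs.v *)
(* The isometry group W of the binary tree X^*, X = {0,1}
   (0 = false, 1 = true), represented by portraits: an isometry g is
   determined by its activity g(v) : bool at each vertex v (whether g swaps
   the two children of v).  Equality of elements of W is Leibniz equality of
   portraits (functions), so proofs may use functional extensionality. *)
From Stdlib Require Import List Bool Arith.
Import ListNotations.

Definition vert := list bool.
Definition W := vert -> bool.

Definition section (g : W) (v : vert) : W := fun u => g (v ++ u).

Fixpoint act (g : W) (v : vert) : vert :=
  match v with
  | [] => []
  | y :: w => xorb (g []) y :: act (section g [y]) w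
  end.

Fixpoint inv_act (g : W) (v : vert) : vert :=
  match v with
  | [] => []
  | y :: w => let y' := xorb (g []) y in y' :: inv_act (section g [y']) w
  end.

Definition one : W := fun _ => false.
(* product with right actions: v^(gh) = (v^g)^h *)
Definition mul (g h : W) : W := fun v => xorb (g v) (h (act g v)).
Definition inv (g : W) : W := fun v => g (inv_act g v).

Definition Delta (g : W) : W :=
  fun v => match v with [] => false | _ :: w => g w end.
Definition Pi (g : W) : W :=
  fun v => match v with [] => false | false :: _ => false | true :: w => g w end.

Fixpoint star (v : vert) (g : W) (u : vert) : bool :=
  match v, u with
  | [], _ => g u
  | y :: v', z :: u' => if Bool.eqb y z then star v' g u' else false
  | _ :: _, [] => false
  end.

(* Grigorchuk generators: a = (1,1)σ, b = (a,c), c = (a,d), d = (1,b) *)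
Definition ga : W := fun v => match v with [] => true | _ => false end.

Inductive BCD := Bb | Bc | Bd.
Definition bcd_next (i : BCD) : BCD :=
  match i with Bb => Bc | Bc => Bd | Bd => Bb end.
Definition bcd_left (i : BCD) : W :=
  match i with Bb => ga | Bc => ga | Bd => one end.

Fixpoint bcd (i : BCD) (v : vert) : bool :=
  match v with
  | [] => false
  | false :: w => bcd_left i w
  | true :: w => bcd (bcd_next i) w
  end.

Definition gb : W := bcd Bb.
Definition gc : W := bcd Bc.
Definition gd : W := bcd Bd.

Inductive gen (S : W -> Prop) : W -> Prop :=
  | gen_base x : S x -> gen S x
  | gen_one : gen S one
  | gen_mul x y : gen S x -> gen S y -> gen S (mul x y)
  | gen_inv x : gen S x -> gen S (inv x).

Definition is_gen_abcd (x : W) : Prop := x = ga \/ x = gb \/ x = gc \/ x = gd.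

Definition Grig : W -> Prop := gen is_gen_abcd.

Definition Gstar : W -> Prop :=
  gen (fun x => exists v g, Grig g /\ x = star v g).

Definition conj (h w : W) : W := mul (mul (inv w) h) w.

Definition normalizer (H : W -> Prop) (w : W) : Prop :=
  (forall h, H h -> H (conj h w)) /\
  (forall k, H k -> exists h, H h /\ k = conj h w).

(* automorphism tower realized in W as the normalizer tower *)
Fixpoint AutT (i : nat) : W -> Prop :=
  match i with
  | 0 => Grig
  | S i => normalizer (AutT i)
  end.

Definition AutOmega (x : W) : Prop := exists i, AutT i x.

(* formal elements of Omega: Zp, Zq, Zr with Z a word over {Δ, π} *)
Inductive om := OP | OQ | OR | ODelta (o : om) | OPi (o : om).

Definition p_el : W := Pi (mul ga (mul gd (mul ga gd))).
Definition q_el : W := Pi (mul ga gd).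
Definition r_el : W := Pi ga.

Fixpoint om_eval (o : om) : W :=
  match o with
  | OP => p_el | OQ => q_el | OR => r_el
  | ODelta o' => Delta (om_eval o')
  | OPi o' => Pi (om_eval o')
  end.

Fixpoint rank (o : om) : nat :=
  match o with
  | OP => 1 | OQ => 2 | OR => 3
  | ODelta o' => 2 * rank o' - 1
  | OPi o' => 2 * rank o'
  end.

(* B/A is a countably infinite elementary abelian 2-group, i.e. ≅ (Z/2)^omega,
   where A ⊴ B ≤ W; cosets A x, x ~ y iff x y^-1 ∈ A *)
Definition quotient_is_Z2_omega (A B : W -> Prop) : Prop :=
  (forall x, B x -> A (mul x x)) /\
  (forall x y, B x -> B y -> A (mul (mul x y) (mul (inv x) (inv y)))) /\
  (exists f : nat -> W, (forall n, B (f n)) /\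
      forall n m, n <> m -> ~ A (mul (f n) (inv (f m)))) /\
  (exists f : nat -> W, (forall n, B (f n)) /\
      forall x, B x -> exists n, A (mul x (inv (f n)))).

(* Main.v *)
(** Write x = (x0, x1) s^e.  Since a lies in every group below, membership
    depends only on (x0, x1).  There is a homomorphism phi from the whole of W onto the
    dihedral group D8, read off the first three levels of the portrait, such that
    x is in G iff x0, x1 are in G and phi x1 is the image of phi x0 under the automorphism
    of D8 = <a, d> exchanging a and d.  From this the normalizer of a group described by a
    condition on the pair (x0, x1) is computed explicitly.  Writing A_i = Aut^i(G), one gets
    successively
      A_1: x0, x1 in A_1, x0^-1 x1 in G, and x0, x1 have exchanged images in D8/Z(D8);
      A_2: x0, x1 in A_1 with the same value of a character chi;
      A_(2j+1): x0, x1 in A_(j+1) and x0^-1 x1 in A_j;     A_(2j+2): x0, x1 in A_(j+1),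
    for j >= 1, all successive quotients having exponent two.
    The descriptions of A_1 and of the normalizer of G_* are recursive and yield generators
    only by a contraction argument along the vertices 1^n.  If w normalizes G or G_*, then
    far enough along this spine the section u of w centralizes b, c, d; it is then determined
    by h = u0^-1 u1, and h is replaced by (h^-1 a h)_0 when u is replaced by its section at 1.
    This operation contracts a weighted word length in G, and finitely many short words
    remain, all leading to h = 1 or h = b, that is, to u = 1 or u = d. *)
Require Import Defs.
From Stdlib Require Import List Bool Arith.
From Stdlib Require Import Lia FunctionalExtensionality.
From Stdlib Require Cantor.
Import ListNotations.

(* The group structure of W, sections and conjugation *)
Local Infix "**" := mul (at level 40, left associativity).
Local Notation sec g y := (section g [y]).

(** Coinduction: the induction on vertices is done once here, so that later identities in W only
    need a relation closed under first-level sections. *)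
Lemma bisim (R : W -> W -> Prop) :
  (forall x y, R x y -> x [] = y [] /\ forall b, R (sec x b) (sec y b)) ->
  forall x y, R x y -> x = y.
Proof.
  intros HR x y Hxy. apply functional_extensionality. intros v.
  revert x y Hxy. induction v as [|b v IH]; intros x y Hxy.
  - apply (HR _ _ Hxy).
  - exact (IH _ _ (proj2 (HR _ _ Hxy) b)).
Qed.

Lemma W_ext (x y : W) :
  x [] = y [] -> sec x false = sec y false -> sec x true = sec y true -> x = y.
Proof.
  intros H H0 H1. apply functional_extensionality. intros [|[] v]; trivial.
  - exact (f_equal (fun g => g v) H1).
  - exact (f_equal (fun g => g v) H0).
Qed.

Lemma mul_nil (x y : W) : (x ** y) [] = xorb (x []) (y []).
Proof. reflexivity. Qed.

Lemma inv_nil (x : W) : inv x [] = x [].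
Proof. reflexivity. Qed.

Lemma sec_mul (x y : W) (b : bool) :
  sec (x ** y) b = sec x b ** sec y (xorb (x []) b).
Proof. reflexivity. Qed.

Lemma sec_inv (x : W) (b : bool) : sec (inv x) b = inv (sec x (xorb (x []) b)).
Proof. reflexivity. Qed.

Lemma mulA (x y z : W) : (x ** y) ** z = x ** (y ** z).
Proof.
  apply (bisim (fun g h => exists x y z, g = (x ** y) ** z /\ h = x ** (y ** z)));
    [|eauto].
  clear. intros g h (x & y & z & -> & ->). split.
  - rewrite !mul_nil. apply xorb_assoc.
  - intros b. rewrite !sec_mul, mul_nil, (xorb_comm (x []) (y [])), xorb_assoc. eauto.
Qed.

Lemma mul1 (x : W) : one ** x = x.
Proof.
  apply (bisim (fun g h => exists x, g = one ** x /\ h = x)); [|eauto].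
  clear. intros g h (x & -> & ->). split; [reflexivity|].
  intros b. exists (sec x b). split; [|reflexivity].
  rewrite sec_mul. destruct b; reflexivity.
Qed.

Lemma mulr1 (x : W) : x ** one = x.
Proof.
  apply (bisim (fun g h => exists x, g = x ** one /\ h = x)); [|eauto].
  clear. intros g h (x & -> & ->). split; [apply xorb_false_r|].
  intros b. exists (sec x b). split; reflexivity.
Qed.

Lemma mulV (x : W) : x ** inv x = one.
Proof.
  apply (bisim (fun g h => exists x, g = x ** inv x /\ h = one)); [|eauto].
  clear. intros g h (x & -> & ->). split; [apply xorb_nilpotent|].
  intros b. exists (sec x b). split; [|reflexivity].
  rewrite sec_mul, sec_inv.
  rewrite <- xorb_assoc, xorb_nilpotent, xorb_false_l. reflexivity.
Qed.

Lemma mulVl (x : W) : inv x ** x = one.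
Proof.
  apply (bisim (fun g h => exists x, g = inv x ** x /\ h = one)); [|eauto].
  clear. intros g h (x & -> & ->). split; [apply xorb_nilpotent|].
  intros b. exists (sec x (xorb (x []) b)). split; [|reflexivity].
  rewrite sec_mul, sec_inv, inv_nil. reflexivity.
Qed.

Lemma mulKV (x y : W) : x ** (inv x ** y) = y.
Proof. rewrite <- mulA, mulV. apply mul1. Qed.

Lemma mulVK (x y : W) : inv x ** (x ** y) = y.
Proof. rewrite <- mulA, mulVl. apply mul1. Qed.

Lemma inv_uniq (x y : W) : x ** y = one -> y = inv x.
Proof. intros H. rewrite <- (mulVK x y), H. apply mulr1. Qed.

Lemma inv_mul (x y : W) : inv (x ** y) = inv y ** inv x.
Proof. symmetry. apply inv_uniq. rewrite mulA, mulKV. apply mulV. Qed.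

Lemma inv_inv (x : W) : inv (inv x) = x.
Proof. symmetry. apply inv_uniq, mulVl. Qed.

Lemma inv_one : inv one = one.
Proof. symmetry. apply inv_uniq, mul1. Qed.

(* The ten rules of the Knuth-Bendix completion of the group axioms: [grp] compares free-group
   normal forms. *)
Create HintDb grp.
Hint Rewrite mulA mul1 mulr1 mulV mulVl mulKV mulVK inv_mul inv_inv inv_one : grp.
Ltac grp := unfold conj; autorewrite with grp; try reflexivity.

Lemma conj_mul (x y w : W) : conj (x ** y) w = conj x w ** conj y w.
Proof. grp. Qed.

Lemma conj_inv (x w : W) : conj (inv x) w = inv (conj x w).
Proof. grp. Qed.

Lemma conj_conj (x v w : W) : conj (conj x v) w = conj x (v ** w).
Proof. grp. Qed.

Lemma conjK (x w : W) : conj (conj x w) (inv w) = x.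
Proof. grp. Qed.

Lemma conjVK (x w : W) : conj (conj x (inv w)) w = x.
Proof. grp. Qed.

Lemma conj_nil (x w : W) : conj x w [] = x [].
Proof. unfold conj. rewrite !mul_nil, inv_nil. destruct (w []), (x []); reflexivity. Qed.

Lemma sec_conj (x w : W) (b : bool) :
  x [] = false -> sec (conj x w) (xorb (w []) b) = conj (sec x b) (sec w b).
Proof.
  intros Hx. unfold conj. rewrite !sec_mul, sec_inv, !mul_nil, inv_nil, Hx.
  destruct (w []), b; reflexivity.
Qed.

(** * Subgroups of W and their normalizers *)

Record subgroup (H : W -> Prop) : Prop := {
  sg1 : H one;
  sgM : forall x y, H x -> H y -> H (x ** y);
  sgV : forall x, H x -> H (inv x) }.

Lemma subgroup_gen (S : W -> Prop) : subgroup (gen S).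
Proof. split; [apply gen_one|apply gen_mul|apply gen_inv]. Qed.

Lemma gen_sub (S H : W -> Prop) :
  subgroup H -> (forall x, S x -> H x) -> forall x, gen S x -> H x.
Proof. intros [H1 HM HV] HS x Hx. induction Hx; auto. Qed.

Lemma gen_mono (S T : W -> Prop) :
  (forall x, S x -> gen T x) -> forall x, gen S x -> gen T x.
Proof. apply gen_sub, subgroup_gen. Qed.

Lemma sgJ (H : W -> Prop) : subgroup H -> forall x y, H x -> H y -> H (conj x y).
Proof. intros [H1 HM HV] x y Hx Hy. unfold conj. auto. Qed.

Ltac sgp HS := repeat first [assumption | apply (sg1 _ HS) | apply (sgM _ HS)
  | apply (sgV _ HS) | apply (sgJ _ HS)].

Lemma sg_cancel_r (H : W -> Prop) (x y : W) :
  subgroup H -> H y -> (H (x ** y) <-> H x).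
Proof.
  intros HS Hy. split; intros Hx; [|now apply (sgM _ HS)].
  replace x with ((x ** y) ** inv y) by grp. sgp HS.
Qed.

Lemma sg_cancel_l (H : W -> Prop) (x y : W) :
  subgroup H -> H x -> (H (x ** y) <-> H y).
Proof.
  intros HS Hx. split; intros Hy; [|now apply (sgM _ HS)].
  replace y with (inv x ** (x ** y)) by grp. sgp HS.
Qed.

(** Surjectivity of conjugation by w on H amounts to [inv w] carrying H into itself, which treats w
    and its inverse alike. *)
Lemma normalizerE (H : W -> Prop) (w : W) :
  normalizer H w <->
  (forall h, H h -> H (conj h w)) /\ (forall h, H h -> H (conj h (inv w))).
Proof.
  split.
  - intros [H1 H2]. split; [exact H1|]. intros h Hh.
    destruct (H2 h Hh) as (k & Hk & ->). now rewrite conjK.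
  - intros [H1 H2]. split; [exact H1|]. intros k Hk.
    exists (conj k (inv w)). now rewrite conjVK; auto.
Qed.

Lemma normalizer_conj (H : W -> Prop) (h w : W) :
  normalizer H w -> (H (conj h w) <-> H h).
Proof.
  rewrite normalizerE. intros [H1 H2]. split; auto.
  intros Hc. rewrite <- (conjK h w). auto.
Qed.

Lemma subgroup_normalizer (H : W -> Prop) : subgroup (normalizer H).
Proof.
  split.
  - apply normalizerE. split; intros h Hh; [replace (conj h one) with h by grp
      |replace (conj h (inv one)) with h by grp]; exact Hh.
  - intros x y [Hx Hx']%normalizerE [Hy Hy']%normalizerE. apply normalizerE.
    rewrite inv_mul. split; intros h Hh; rewrite <- conj_conj; auto.
  - intros x [Hx Hx']%normalizerE. apply normalizerE. rewrite inv_inv. auto.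
Qed.

Lemma normalizer_incl (H : W -> Prop) :
  subgroup H -> forall x, H x -> normalizer H x.
Proof. intros HS x Hx. apply normalizerE. split; intros h Hh; sgp HS. Qed.

(** The commutator is the product of the square of xy, a conjugate of the inverse square of x, and
    the inverse square of y. *)
Lemma exponent2_comm (A B : W -> Prop) :
  subgroup A -> subgroup B -> (forall x, B x -> normalizer A x) ->
  (forall x, B x -> A (x ** x)) ->
  forall x y, B x -> B y -> A ((x ** y) ** (inv x ** inv y)).
Proof.
  intros HA HB HN H2 x y Hx Hy.
  replace ((x ** y) ** (inv x ** inv y))
    with (((x ** y) ** (x ** y)) ** conj (inv (x ** x)) y ** inv (y ** y)) by grp.
  apply (sgM _ HA); [apply (sgM _ HA); [apply H2; sgp HB|]|apply (sgV _ HA); auto].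
  apply (normalizer_conj A _ y (HN y Hy)). apply (sgV _ HA); auto.
Qed.

(** * The generators, the maps Delta and Pi, and their sections *)

Lemma sec_one (b : bool) : sec one b = one.
Proof. reflexivity. Qed.

Lemma sec_ga (b : bool) : sec ga b = one.
Proof. reflexivity. Qed.

Lemma sec_bcd0 (i : BCD) : sec (bcd i) false = bcd_left i.
Proof. reflexivity. Qed.

Lemma sec_bcd1 (i : BCD) : sec (bcd i) true = bcd (bcd_next i).
Proof. reflexivity. Qed.

Lemma bcd_nil (i : BCD) : bcd i [] = false.
Proof. reflexivity. Qed.

Lemma sec_gens :
  ((sec gb false = ga /\ sec gb true = gc) /\
   (sec gc false = ga /\ sec gc true = gd)) /\
  (sec gd false = one /\ sec gd true = gb).
Proof. repeat split. Qed.

Lemma nil_gens : (ga [] = true /\ gb [] = false) /\ (gc [] = false /\ gd [] = false).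
Proof. repeat split. Qed.

Lemma sec_Delta (x : W) (b : bool) : sec (Delta x) b = x.
Proof. reflexivity. Qed.

Lemma sec_Pi0 (x : W) : sec (Pi x) false = one.
Proof. reflexivity. Qed.

Lemma sec_Pi1 (x : W) : sec (Pi x) true = x.
Proof. reflexivity. Qed.

Lemma Delta_nil (x : W) : Delta x [] = false.
Proof. reflexivity. Qed.

Lemma Pi_nil (x : W) : Pi x [] = false.
Proof. reflexivity. Qed.

Lemma one_nil : one [] = false.
Proof. reflexivity. Qed.

Create HintDb secs.
Hint Rewrite sec_mul sec_inv mul_nil inv_nil sec_one sec_ga sec_bcd0 sec_bcd1 bcd_nil
  (proj1 (proj1 (proj1 sec_gens))) (proj2 (proj1 (proj1 sec_gens)))
  (proj1 (proj2 (proj1 sec_gens))) (proj2 (proj2 (proj1 sec_gens)))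
  (proj1 (proj2 sec_gens)) (proj2 (proj2 sec_gens))
  (proj1 (proj1 nil_gens)) (proj2 (proj1 nil_gens))
  (proj1 (proj2 nil_gens)) (proj2 (proj2 nil_gens))
  sec_Delta sec_Pi0 sec_Pi1 Delta_nil Pi_nil one_nil : secs.
Ltac secs := unfold conj; repeat (progress (autorewrite with secs; cbn [xorb negb])).

Lemma gaK : ga ** ga = one.
Proof. apply W_ext; [reflexivity|secs; grp|secs; grp]. Qed.

Lemma bcdK (i : BCD) : bcd i ** bcd i = one.
Proof.
  apply (bisim (fun g h => g = h \/ exists i, g = bcd i ** bcd i /\ h = one));
    [|eauto].
  clear. intros g h [->|(i & -> & ->)]; [auto|]. split; [reflexivity|].
  intros [|]; secs; [eauto|].
  left. destruct i; cbn [bcd_left]; auto using gaK; grp.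
Qed.

Definition bcd_third (i j : BCD) : BCD :=
  match i, j with
  | Bb, Bc | Bc, Bb => Bd
  | Bb, Bd | Bd, Bb => Bc
  | Bc, Bd | Bd, Bc => Bb
  | _, _ => i
  end.

Lemma bcd_mul (i j : BCD) : i <> j -> bcd i ** bcd j = bcd (bcd_third i j).
Proof.
  intros Hij. apply (bisim (fun g h => g = h \/
    exists i j, i <> j /\ g = bcd i ** bcd j /\ h = bcd (bcd_third i j))); [|eauto 6].
  clear. intros g h [->|(i & j & Hij & -> & ->)]; [auto|]. split; [reflexivity|].
  intros [|]; secs.
  - right. exists (bcd_next i), (bcd_next j).
    destruct i, j; try (now destruct Hij); repeat split; discriminate.
  - left. destruct i, j; try (now destruct Hij); cbn [bcd_left bcd_third];
      rewrite ?gaK; grp.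
Qed.

Lemma bcd_comm (i j : BCD) : bcd i ** bcd j = bcd j ** bcd i.
Proof. destruct i, j; rewrite ?bcd_mul by discriminate; reflexivity. Qed.

Lemma inv_ga : inv ga = ga.
Proof. symmetry. apply inv_uniq, gaK. Qed.

Lemma inv_bcd (i : BCD) : inv (bcd i) = bcd i.
Proof. symmetry. apply inv_uniq, bcdK. Qed.

Lemma Delta_mul (x y : W) : Delta (x ** y) = Delta x ** Delta y.
Proof. apply W_ext; reflexivity. Qed.

Lemma Delta_inv (x : W) : Delta (inv x) = inv (Delta x).
Proof. apply W_ext; reflexivity. Qed.

Lemma Delta_one : Delta one = one.
Proof. apply W_ext; reflexivity. Qed.

Lemma Pi_mul (x y : W) : Pi (x ** y) = Pi x ** Pi y.
Proof. apply W_ext; [reflexivity|secs; grp|reflexivity]. Qed.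

Lemma Pi_inv (x : W) : Pi (inv x) = inv (Pi x).
Proof. apply W_ext; [reflexivity|secs; grp|reflexivity]. Qed.

Lemma Pi_one : Pi one = one.
Proof. apply W_ext; reflexivity. Qed.

Lemma subgroup_Delta (H : W -> Prop) : subgroup H -> subgroup (fun x => H (Delta x)).
Proof.
  intros HS. split; [rewrite Delta_one; apply (sg1 _ HS)|intros x y|intros x];
    rewrite ?Delta_mul, ?Delta_inv; intros; sgp HS.
Qed.

Lemma subgroup_Pi (H : W -> Prop) : subgroup H -> subgroup (fun x => H (Pi x)).
Proof.
  intros HS. split; [rewrite Pi_one; apply (sg1 _ HS)|intros x y|intros x];
    rewrite ?Pi_mul, ?Pi_inv; intros; sgp HS.
Qed.

(** * Words in the four generators *)

Definition letter := option BCD.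

Definition leval (l : letter) : W := match l with None => ga | Some i => bcd i end.

Definition weval (w : list letter) : W := fold_right (fun l g => leval l ** g) one w.

Lemma leval_inv (l : letter) : inv (leval l) = leval l.
Proof. destruct l; [apply inv_bcd|apply inv_ga]. Qed.

Lemma weval_cons (l : letter) (w : list letter) : weval (l :: w) = leval l ** weval w.
Proof. reflexivity. Qed.

Lemma weval_app (v w : list letter) : weval (v ++ w) = weval v ** weval w.
Proof.
  induction v as [|l v IH]; [symmetry; apply mul1|].
  cbn [app]. rewrite !weval_cons, IH. grp.
Qed.

Lemma weval_rev (w : list letter) : weval (rev w) = inv (weval w).
Proof.
  induction w as [|l w IH]; [symmetry; apply inv_one|].
  cbn [rev]. rewrite weval_app, IH, !weval_cons. cbn [weval fold_right].
  rewrite mulr1, inv_mul, leval_inv. reflexivity.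
Qed.

Lemma Grig_subgroup : subgroup Grig.
Proof. apply subgroup_gen. Qed.

Lemma Grig_leval (l : letter) : Grig (leval l).
Proof. apply gen_base. unfold is_gen_abcd. destruct l as [[]|]; auto. Qed.

Lemma Grig_ga : Grig ga.
Proof. exact (Grig_leval None). Qed.

Lemma Grig_bcd (i : BCD) : Grig (bcd i).
Proof. exact (Grig_leval (Some i)). Qed.

Lemma Grig_gb : Grig gb. Proof. exact (Grig_bcd Bb). Qed.
Lemma Grig_gc : Grig gc. Proof. exact (Grig_bcd Bc). Qed.
Lemma Grig_gd : Grig gd. Proof. exact (Grig_bcd Bd). Qed.

(** The generators are involutions, so words need no inverse letters and reversing a word inverts
    its value. *)
Lemma Grig_word (g : W) : Grig g -> exists w, g = weval w.
Proof.
  intros Hg. induction Hg as [x Hx| |x y _ [v ->] _ [w ->]|x _ [v ->]].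
  - destruct Hx as [->|[->|[->| ->]]];
      [exists [None]|exists [Some Bb]|exists [Some Bc]|exists [Some Bd]];
      cbn [weval fold_right]; rewrite mulr1; reflexivity.
  - now exists [].
  - exists (v ++ w). now rewrite weval_app.
  - exists (rev v). now rewrite weval_rev.
Qed.

(** * A dihedral quotient of W *)

Definition lev1 (x : W) : bool := xorb (x [false]) (x [true]).
Definition lev2 (x : W) : bool := xorb (lev1 (sec x false)) (lev1 (sec x true)).
(** The combination of level sums that vanishes on a and b and equals 1 on c and d. *)
Definition del (x : W) : bool := xorb (lev1 x) (lev2 x).
(** Not a homomorphism: its defect, found in [kap_mul], is the cocycle that makes it the corner
    entry of a unitriangular matrix. *)
Definition kap (x : W) : bool := xorb (lev1 (sec x false)) (x [true]).
(** The character of D8 with value 1 on both a and d, hence invariant under their exchange. *)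
Definition chi (x : W) : bool := xorb (x []) (del x).

(** An isometry only permutes the vertices of a level, so sums of activities over a level are
    additive. *)
Lemma lev1_mul (x y : W) : lev1 (x ** y) = xorb (lev1 x) (lev1 y).
Proof.
  unfold lev1.
  change ((x ** y) [false]) with (xorb (x [false]) (y [xorb (x []) false])).
  change ((x ** y) [true]) with (xorb (x [true]) (y [xorb (x []) true])).
  destruct (x []), (x [false]), (x [true]); cbn [xorb negb];
    destruct (y [false]), (y [true]); reflexivity.
Qed.

Lemma lev2_mul (x y : W) : lev2 (x ** y) = xorb (lev2 x) (lev2 y).
Proof.
  unfold lev2. rewrite !sec_mul, !lev1_mul.
  destruct (x []), (lev1 (sec x false)), (lev1 (sec x true)); cbn [xorb negb];
    destruct (lev1 (sec y false)), (lev1 (sec y true)); reflexivity.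
Qed.

Lemma del_mul (x y : W) : del (x ** y) = xorb (del x) (del y).
Proof.
  unfold del. rewrite lev1_mul, lev2_mul.
  destruct (lev1 x), (lev1 y), (lev2 x), (lev2 y); reflexivity.
Qed.

Lemma chi_mul (x y : W) : chi (x ** y) = xorb (chi x) (chi y).
Proof.
  unfold chi. rewrite del_mul, mul_nil.
  destruct (x []), (y []), (del x), (del y); reflexivity.
Qed.

Lemma kap_mul (x y : W) :
  kap (x ** y) = xorb (xorb (kap x) (kap y)) (andb (x []) (del y)).
Proof.
  unfold kap, del, lev2. rewrite sec_mul, lev1_mul.
  change ((x ** y) [true]) with (xorb (x [true]) (y [xorb (x []) true])).
  destruct (x []), (lev1 (sec x false)), (x [true]); cbn [xorb negb andb];
    change (lev1 y) with (xorb (y [false]) (y [true]));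
    destruct (lev1 (sec y false)), (lev1 (sec y true)), (y [true]), (y [false]);
    reflexivity.
Qed.

Definition D8 : Type := bool * bool * bool.

(* (x, y, z) stands for the upper unitriangular matrix over F_2 with entries x, y on
   the superdiagonal and z in the corner; dswap is the automorphism exchanging the two
   elementary generators, which are the images of a and d under phi below. *)
Definition dmul (s t : D8) : D8 :=
  let '(x, y, z) := s in let '(x', y', z') := t in
  (xorb x x', xorb y y', xorb (xorb z z') (andb x y')).

Definition dswap (s : D8) : D8 :=
  let '(x, y, z) := s in (y, x, xorb z (andb x y)).

Definition dunit : D8 := (false, false, false).

Definition dinv (s : D8) : D8 :=
  let '(x, y, z) := s in (x, y, xorb z (andb x y)).

Definition phi (x : W) : D8 := (x [], del x, kap x).

Lemma phi_mul (x y : W) : phi (x ** y) = dmul (phi x) (phi y).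
Proof. unfold phi, dmul. rewrite del_mul, kap_mul, mul_nil. reflexivity. Qed.

Ltac d8 := repeat match goal with s : D8 |- _ => destruct s as [[[] []] []] end;
  try reflexivity; try (intros; discriminate).

Lemma dmulA (s t u : D8) : dmul (dmul s t) u = dmul s (dmul t u).
Proof. d8. Qed.

Lemma dmulVl (s : D8) : dmul (dinv s) s = dunit.
Proof. d8. Qed.

Lemma dinv_uniq (s t : D8) : dmul s t = dunit -> t = dinv s.
Proof. d8. Qed.

Lemma dswap_mul (s t : D8) : dswap (dmul s t) = dmul (dswap s) (dswap t).
Proof. d8. Qed.

Lemma dswap_inv (s : D8) : dswap (dinv s) = dinv (dswap s).
Proof. d8. Qed.

Lemma dswapK (s : D8) : dswap (dswap s) = s.
Proof. d8. Qed.

Lemma phi_inv (x : W) : phi (inv x) = dinv (phi x).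
Proof. apply dinv_uniq. rewrite <- phi_mul, mulV. reflexivity. Qed.

Lemma del_inv (x : W) : del (inv x) = del x.
Proof.
  assert (H := del_mul x (inv x)). rewrite mulV in H. change (del one) with false in H.
  destruct (del x), (del (inv x)); auto; discriminate.
Qed.

Lemma lev1_inv (x : W) : lev1 (inv x) = lev1 x.
Proof.
  assert (H := lev1_mul x (inv x)). rewrite mulV in H. change (lev1 one) with false in H.
  destruct (lev1 x), (lev1 (inv x)); auto; discriminate.
Qed.

Lemma lev2_inv (x : W) : lev2 (inv x) = lev2 x.
Proof.
  assert (H := lev2_mul x (inv x)). rewrite mulV in H. change (lev2 one) with false in H.
  destruct (lev2 x), (lev2 (inv x)); auto; discriminate.
Qed.

Lemma chi_inv (x : W) : chi (inv x) = chi x.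
Proof. unfold chi. now rewrite del_inv, inv_nil. Qed.

Lemma phi_ga : phi ga = (true, false, false). Proof. reflexivity. Qed.
Lemma phi_gb : phi gb = dunit. Proof. reflexivity. Qed.
Lemma phi_gd : phi gd = (false, true, false). Proof. reflexivity. Qed.

(** * The first-level decomposition of the Grigorchuk group *)

(** The condition is symmetric in the two sections because [dswap] is an involution; hence it
    survives a factor that exchanges them. *)
Lemma Grig_sections (x : W) : Grig x ->
  Grig (sec x false) /\ Grig (sec x true) /\
  phi (sec x true) = dswap (phi (sec x false)).
Proof.
  intros Hx. induction Hx as [x Hx| |x y _ (X0 & X1 & X) _ (Y0 & Y1 & Y)|x _ (X0 & X1 & X)].
  - destruct Hx as [->|[->|[->| ->]]]; secs;
      (split; [|split]); auto using Grig_ga, Grig_gb, Grig_gc, Grig_gd, gen_one;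
      apply gen_one.
  - split; [|split]; [apply gen_one..|reflexivity].
  - rewrite !sec_mul, !phi_mul.
    destruct (x []); cbn [xorb negb]; rewrite X, Y;
      (split; [|split]); try (apply gen_mul; assumption);
      rewrite dswap_mul, ?dswapK; reflexivity.
  - rewrite !sec_inv, !phi_inv.
    destruct (x []); cbn [xorb negb]; rewrite X;
      (split; [|split]); try (apply gen_inv; assumption);
      rewrite <- dswap_inv, ?dswapK; reflexivity.
Qed.

(** Among elements fixing the first level, b and the conjugates of d, b, c by a have a, b, c, d as
    sections at 0. *)
Lemma Grig_lift (g : W) : Grig g ->
  exists x, Grig x /\ x [] = false /\ sec x false = g.
Proof.
  intros Hg. induction Hg as [x Hx| |x y _ (X & GX & AX & <-) _ (Y & GY & AY & <-)
                             |x _ (X & GX & AX & <-)].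
  - destruct Hx as [->|[->|[->| ->]]].
    + exists gb. auto using Grig_gb.
    + exists (conj gd ga). split; [|split]; [|reflexivity|].
      * apply (sgJ _ Grig_subgroup); [apply Grig_gd|apply Grig_ga].
      * secs. grp.
    + exists (conj gb ga). split; [|split]; [|reflexivity|].
      * apply (sgJ _ Grig_subgroup); [apply Grig_gb|apply Grig_ga].
      * secs. grp.
    + exists (conj gc ga). split; [|split]; [|reflexivity|].
      * apply (sgJ _ Grig_subgroup); [apply Grig_gc|apply Grig_ga].
      * secs. grp.
  - exists one. split; [apply gen_one|split; reflexivity].
  - exists (X ** Y). split; [now apply gen_mul|]. rewrite mul_nil, sec_mul, AX, AY.
    split; reflexivity.
  - exists (inv X). split; [now apply gen_inv|]. rewrite inv_nil, sec_inv, AX.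
    split; reflexivity.
Qed.

Lemma Grig_lift1 (g : W) : Grig g ->
  exists x, Grig x /\ x [] = false /\ sec x true = g.
Proof.
  intros (x & Hx & Ax & <-)%Grig_lift. exists (conj x ga).
  split; [apply (sgJ _ Grig_subgroup); [exact Hx|apply Grig_ga]|].
  split; [now rewrite conj_nil|]. secs. grp.
Qed.

Definition bnormal : W -> Prop := gen (fun x => exists g, Grig g /\ x = conj gb g).

(** Since d = (1, b), conjugating d by a lift of g gives the pair of 1 and [conj gb g]. *)
Lemma Grig_Pi_bnormal (n : W) : bnormal n -> Grig (Pi n).
Proof.
  apply (gen_sub _ (fun x => Grig (Pi x))); [apply (subgroup_Pi _ Grig_subgroup)|].
  intros x (g & Hg & ->). destruct (Grig_lift1 g Hg) as (y & Hy & Ay & <-).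
  replace (Pi (conj gb (sec y true))) with (conj gd y).
  - apply (sgJ _ Grig_subgroup); [apply Grig_gd|exact Hy].
  - apply W_ext.
    + now rewrite conj_nil.
    + secs. rewrite Ay. secs. grp.
    + secs. rewrite Ay. secs. reflexivity.
Qed.

Lemma adad : ga ** (gd ** (ga ** gd)) = Delta gb.
Proof. apply W_ext; [reflexivity|secs; grp|secs; grp]. Qed.

Lemma dada : gd ** (ga ** (gd ** ga)) = Delta gb.
Proof. apply W_ext; [reflexivity|secs; grp|secs; grp]. Qed.

(** As adad = dada, the element ad has order dividing four and these eight words exhaust the group
    generated by a and d. *)
Definition dihedral (e : W) : Prop :=
  In e [one; ga; gd; ga ** gd; gd ** ga; ga ** (gd ** ga); gd ** (ga ** gd);
        ga ** (gd ** (ga ** gd))].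

Lemma ga_cancel (x : W) : ga ** (ga ** x) = x.
Proof. rewrite <- inv_ga at 1. apply mulVK. Qed.

Lemma gd_cancel (x : W) : gd ** (gd ** x) = x.
Proof. rewrite <- (inv_bcd Bd) at 1. apply mulVK. Qed.

Lemma dihedral_ga (e : W) : dihedral e -> dihedral (ga ** e).
Proof.
  intros He. repeat (destruct He as [<-|He]); [..|destruct He];
    rewrite ?ga_cancel, ?gaK, ?mulr1; unfold dihedral; cbn [In]; tauto.
Qed.

Lemma dihedral_gd (e : W) : dihedral e -> dihedral (gd ** e).
Proof.
  intros He. repeat (destruct He as [<-|He]); [..|destruct He];
    rewrite ?dada, <- ?adad, ?gd_cancel, ?(bcdK Bd : gd ** gd = one), ?mulr1;
    unfold dihedral; cbn [In]; try tauto.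
  rewrite adad, <- dada, gd_cancel. tauto.
Qed.

Lemma dihedral_Grig (e : W) : dihedral e -> Grig e.
Proof.
  intros He. repeat (destruct He as [<-|He]); [..|destruct He];
    repeat first [apply Grig_ga|apply Grig_gd|apply gen_one|apply gen_mul].
Qed.

(** The letter c is eliminated by c = db, and a letter b in front of e is moved behind e as a
    conjugate. *)
Lemma Grig_dihedral_bnormal (g : W) : Grig g ->
  exists e n, dihedral e /\ bnormal n /\ g = e ** n.
Proof.
  intros [w ->]%Grig_word. induction w as [|l w (e & n & He & Hn & IH)].
  - exists one, one. split; [now left|]. split; [apply gen_one|]. symmetry. apply mul1.
  - rewrite weval_cons, IH.
    assert (Hb : bnormal (conj gb e ** n)).
    { apply gen_mul; [apply gen_base|exact Hn]. exists e. auto using dihedral_Grig. }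
    destruct l as [[]|]; cbn [leval].
    + exists e, (conj gb e ** n). repeat split; auto. fold gb. grp.
    + exists (gd ** e), (conj gb e ** n). repeat split; auto using dihedral_gd.
      replace (bcd Bc) with (gd ** gb) by (apply (bcd_mul Bd Bb); discriminate). grp.
    + exists (gd ** e), n. repeat split; auto using dihedral_gd. fold gd. grp.
    + exists (ga ** e), n. repeat split; auto using dihedral_ga. grp.
Qed.

Lemma bnormal_phi (n : W) : bnormal n -> phi n = dunit.
Proof.
  intros Hn. induction Hn as [x (g & _ & ->)| |x y _ X _ Y|x _ X].
  - unfold conj. rewrite !phi_mul, phi_inv, phi_gb. generalize (phi g). intros s. d8.
  - reflexivity.
  - now rewrite phi_mul, X, Y.
  - now rewrite phi_inv, X.
Qed.

(** [phi] kills the normal closure of b and only 1 among the dihedral elements, so its kernel in G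
    is that normal closure. *)
Lemma Grig_Pi_ker (g : W) : Grig g -> phi g = dunit -> Grig (Pi g).
Proof.
  intros (e & n & He & Hn & ->)%Grig_dihedral_bnormal Hp.
  rewrite phi_mul, (bnormal_phi n Hn) in Hp.
  assert (He1 : e = one).
  { repeat (destruct He as [<-|He]); [..|destruct He]; [reflexivity|..];
      exfalso; revert Hp; vm_compute; discriminate. }
  rewrite He1, mul1. now apply Grig_Pi_bnormal.
Qed.

Lemma GrigE (x : W) : Grig x <->
  Grig (sec x false) /\ Grig (sec x true) /\
  phi (sec x true) = dswap (phi (sec x false)).
Proof.
  split; [apply Grig_sections|]. intros (X0 & X1 & X).
  destruct (Grig_lift _ X0) as (y & Hy & Ay & E).
  destruct (Grig_sections y Hy) as (_ & Y1 & Y).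
  (* The lift y agrees with x at 0, and k is the discrepancy at 1. Both sections at 1 have the same
     image under [phi]. *)
  set (k := inv (sec y true) ** sec x true).
  assert (Hk : Grig (Pi k)).
  { apply Grig_Pi_ker; [now apply gen_mul; [apply gen_inv|]|].
    unfold k. rewrite phi_mul, phi_inv, X, Y, E. apply dmulVl. }
  assert (Hxy : x = y ** Pi k ** (if x [] then ga else one)).
  { apply W_ext; destruct (x []) eqn:Ax; secs; rewrite ?Ax, ?Ay; secs; rewrite ?E;
      unfold k; grp. }
  rewrite Hxy. apply gen_mul; [now apply gen_mul|].
  destruct (x []); [apply Grig_ga|apply gen_one].
Qed.

(** * Contraction *)

Fixpoint at_level (P : W -> Prop) (n : nat) (g : W) : Prop :=
  match n with
  | 0 => P g
  | S n => at_level P n (sec g false) /\ at_level P n (sec g true)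
  end.

Lemma at_level_sec (P : W -> Prop) (n : nat) (g : W) (b : bool) :
  at_level P (S n) g -> at_level P n (sec g b).
Proof. intros [H0 H1]. destruct b; assumption. Qed.

Lemma at_level_mono (P Q : W -> Prop) (n : nat) :
  (forall g, P g -> Q g) -> forall g, at_level P n g -> at_level Q n g.
Proof. intros HPQ. induction n as [|n IH]; cbn; [auto|]. intros g [H0 H1]. auto. Qed.

Lemma at_level_le (P : W -> Prop) (m n : nat) :
  (forall g b, P g -> P (sec g b)) -> m <= n ->
  forall g, at_level P m g -> at_level P n g.
Proof.
  intros HP Hmn. induction Hmn as [|n Hmn IH]; [auto|]. intros g Hg%IH.
  revert g Hg. clear - HP. induction n as [|n IH]; intros g Hg.
  - split; apply HP, Hg.
  - split; apply IH, at_level_sec, Hg.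
Qed.

Lemma at_level_inv (P : W -> Prop) (n : nat) :
  (forall g, P g -> P (inv g)) -> forall g, at_level P n g -> at_level P n (inv g).
Proof.
  intros HP. induction n as [|n IH]; [exact HP|]. intros g Hg.
  split; rewrite sec_inv; apply IH, at_level_sec, Hg.
Qed.

Lemma at_level_mul (P Q : W -> Prop) (n : nat) :
  (forall g h, P g -> P h -> Q (g ** h)) ->
  forall g h, at_level P n g -> at_level P n h -> at_level Q n (g ** h).
Proof.
  intros HP. induction n as [|n IH]; [exact HP|]. intros g h Hg Hh.
  split; rewrite sec_mul; apply IH; apply at_level_sec; assumption.
Qed.

Definition nucleus (g : W) : Prop := g = one \/ g = ga \/ exists i, g = bcd i.

Lemma nucleus_sec (g : W) (b : bool) : nucleus g -> nucleus (sec g b).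
Proof.
  unfold nucleus. intros [->|[->|[i ->]]]; [now left..|].
  destruct b; [right; right; now exists (bcd_next i)|].
  destruct i; cbn [bcd_left]; auto.
Qed.

Lemma nucleus_inv (g : W) : nucleus g -> nucleus (inv g).
Proof.
  intros [->|[->|[i ->]]]; rewrite ?inv_one, ?inv_ga, ?inv_bcd; unfold nucleus; eauto.
Qed.

(** A factor a has trivial sections, so the product has those of the other factor, up to order; all
    remaining products lie in the nucleus itself. *)
Lemma nucleus_mul_sec (g h : W) (b : bool) :
  nucleus g -> nucleus h -> nucleus (sec (g ** h) b).
Proof.
  intros [->|[->|[i ->]]] Hh.
  - rewrite mul1. now apply nucleus_sec.
  - rewrite sec_mul, sec_ga, mul1. now apply nucleus_sec.
  - destruct Hh as [->|[->|[j ->]]].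
    + rewrite mulr1. apply nucleus_sec. unfold nucleus. eauto.
    + rewrite sec_mul, sec_ga, mulr1. apply nucleus_sec. unfold nucleus. eauto.
    + assert (Hij : i = j \/ i <> j) by (destruct i, j; auto; right; discriminate).
      apply nucleus_sec. unfold nucleus. destruct Hij as [<-|Hij].
      * left. apply bcdK.
      * rewrite bcd_mul; eauto.
Qed.

(** These elements form a subgroup containing G and [Gstar], so one contraction argument serves both
    normalizers. *)
Definition contracting (g : W) : Prop := exists n, at_level nucleus n g.

Lemma contracting_sections (g : W) :
  contracting (sec g false) -> contracting (sec g true) -> contracting g.
Proof.
  intros [m Hm] [n Hn]. exists (S (max m n)).
  split; [apply (at_level_le _ m)|apply (at_level_le _ n)]; auto using nucleus_sec; lia.
Qed.

Lemma contracting_nucleus (g : W) : nucleus g -> contracting g.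
Proof. now exists 0. Qed.

Lemma contracting_subgroup : subgroup contracting.
Proof.
  split.
  - apply contracting_nucleus. now left.
  (* The extra level brings a product of two nucleus elements back into the nucleus. *)
  - intros x y [m Hm] [n Hn]. exists (max m n + 1).
    assert (Hx : at_level nucleus (max m n) x)
      by (apply (at_level_le _ m); auto using nucleus_sec; lia).
    assert (Hy : at_level nucleus (max m n) y)
      by (apply (at_level_le _ n); auto using nucleus_sec; lia).
    clear Hm Hn. revert x y Hx Hy. generalize (max m n). clear m n.
    induction n as [|n IH]; intros x y Hx Hy.
    + split; now apply nucleus_mul_sec.
    + split; rewrite sec_mul; apply IH; now apply at_level_sec.
  - intros x [m Hm]. exists m. apply at_level_inv; auto using nucleus_inv.
Qed.

Lemma contracting_Grig (g : W) : Grig g -> contracting g.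
Proof.
  apply gen_sub; [apply contracting_subgroup|].
  intros x Hx. apply contracting_nucleus. unfold nucleus.
  destruct Hx as [->|[->|[->| ->]]]; eauto;
    right; right; [now exists Bb|now exists Bc|now exists Bd].
Qed.

Lemma contracting_star (v : vert) (g : W) : contracting g -> contracting (star v g).
Proof.
  intros Hg. induction v as [|b v IH]; [exact Hg|].
  assert (H1 : contracting one) by apply (sg1 _ contracting_subgroup).
  apply contracting_sections; destruct b; assumption.
Qed.

Lemma contracting_Gstar (g : W) : Gstar g -> contracting g.
Proof.
  apply gen_sub; [apply contracting_subgroup|].
  intros x (v & h & Hh & ->). now apply contracting_star, contracting_Grig.
Qed.

Lemma nucleus_Grig (g : W) : nucleus g -> Grig g.
Proof. intros [->|[->|[i ->]]]; [apply gen_one|apply Grig_ga|apply Grig_bcd]. Qed.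

(** * Descent along the vertices 1^n *)

Fixpoint spine (n : nat) (w : W) : W :=
  match n with 0 => w | S n => spine n (sec w true) end.

Lemma spine_add (m n : nat) (w : W) : spine (m + n) w = spine n (spine m w).
Proof. revert w. induction m as [|m IH]; intros w; [reflexivity|apply IH]. Qed.

Definition fixes_bcd (u : W) : Prop := forall i, conj (bcd i) u = bcd i.

Lemma lev1_conj (x w : W) : lev1 (conj x w) = lev1 x.
Proof.
  unfold conj. rewrite !lev1_mul, lev1_inv. destruct (lev1 x), (lev1 w); reflexivity.
Qed.

Lemma lev2_conj (x w : W) : lev2 (conj x w) = lev2 x.
Proof.
  unfold conj. rewrite !lev2_mul, lev2_inv. destruct (lev2 x), (lev2 w); reflexivity.
Qed.

(** Root activity, [lev1] and [lev2] are conjugation invariants, and these three bits separate the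
    five elements of the nucleus. *)
Lemma fixes_bcd_of_nucleus (u : W) :
  (forall i, nucleus (conj (bcd i) u)) -> fixes_bcd u.
Proof.
  intros Hu i.
  assert (H1 := lev1_conj (bcd i) u). assert (H2 := lev2_conj (bcd i) u).
  assert (H0 := conj_nil (bcd i) u).
  destruct (Hu i) as [E|[E|[j E]]]; rewrite E in *;
    destruct i; try destruct j; try reflexivity;
    exfalso; vm_compute in H0, H1, H2; congruence.
Qed.

(** Of the sections a and c of b only a is active at its root, so an element commuting with b cannot
    exchange the two subtrees. *)
Lemma fixes_bcd_nil (u : W) : fixes_bcd u -> u [] = false.
Proof.
  intros Hu. destruct (u []) eqn:Au; [|reflexivity].
  assert (H := f_equal (fun g => sec g false []) (Hu Bb)). cbv beta in H.
  replace false with (xorb (u []) true) in H at 1 by now rewrite Au.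
  rewrite sec_conj, conj_nil in H by reflexivity. discriminate.
Qed.

(** Taking the section at 1 permutes b, c, d cyclically. *)
Lemma fixes_bcd_sec1 (u : W) : fixes_bcd u -> fixes_bcd (sec u true).
Proof.
  intros Hu. assert (Au := fixes_bcd_nil u Hu).
  assert (H : forall i, conj (bcd (bcd_next i)) (sec u true) = bcd (bcd_next i)).
  { intros i. rewrite <- sec_bcd1, <- (sec_conj (bcd i) u true) by reflexivity.
    rewrite Au. cbn [xorb]. now rewrite Hu. }
  intros []; [apply (H Bd)|apply (H Bb)|apply (H Bc)].
Qed.

Lemma fixes_bcd_sec0 (u : W) : fixes_bcd u -> conj ga (sec u false) = ga.
Proof.
  intros Hu. assert (Au := fixes_bcd_nil u Hu).
  change ga with (sec (bcd Bb) false) at 1.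
  rewrite <- (sec_conj (bcd Bb) u false) by reflexivity. now rewrite Au, Hu.
Qed.

Lemma fixes_bcd_spine (n : nat) (u : W) : fixes_bcd u -> fixes_bcd (spine n u).
Proof. revert u. induction n as [|n IH]; [auto|]. intros u Hu%fixes_bcd_sec1. now apply IH. Qed.

Lemma fixes_bcd_of_contracting (w : W) :
  (forall i, contracting (conj (bcd i) w)) -> exists n, fixes_bcd (spine n w).
Proof.
  intros Hw.
  assert (exists n, forall i, at_level nucleus n (conj (bcd i) w)) as [n Hn].
  { destruct (Hw Bb) as [k Hk], (Hw Bc) as [l Hl], (Hw Bd) as [m Hm].
    exists (k + l + m). intros []; [apply (at_level_le _ k)|apply (at_level_le _ l)|
      apply (at_level_le _ m)]; auto using nucleus_sec; lia. }
  exists n. clear Hw. revert w Hn. induction n as [|n IH]; intros w Hw.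
  - apply fixes_bcd_of_nucleus, Hw.
  - apply IH.
    assert (H : forall i, at_level nucleus n (conj (bcd (bcd_next i)) (sec w true))).
    { intros i. rewrite <- sec_bcd1, <- (sec_conj (bcd i) w true) by reflexivity.
      apply at_level_sec, Hw. }
    intros []; [apply (H Bd)|apply (H Bb)|apply (H Bc)].
Qed.

Definition ratio (u : W) : W := inv (sec u false) ** sec u true.

Definition next_ratio (h : W) : W := sec (conj ga h) false.

Lemma next_ratioE (h : W) :
  next_ratio h = inv (sec h (h [])) ** sec h (negb (h [])).
Proof. unfold next_ratio. secs. destruct (h []); cbn [xorb negb]; grp. Qed.

Lemma ratio_conj_ga (u : W) : u [] = false -> sec (conj ga u) false = ratio u.
Proof. intros Au. change (next_ratio u = ratio u). now rewrite next_ratioE, Au. Qed.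

(* Since conj ga (sec u false) = ga, conjugation of ga by the section of u at 1 is
   conjugation by ratio u. *)
Lemma ratio_sec1 (u : W) : fixes_bcd u -> ratio (sec u true) = next_ratio (ratio u).
Proof.
  intros Hu. rewrite <- ratio_conj_ga by apply fixes_bcd_nil, fixes_bcd_sec1, Hu.
  unfold next_ratio. replace (sec u true) with (sec u false ** ratio u) at 1
    by (unfold ratio; grp).
  now rewrite <- conj_conj, fixes_bcd_sec0.
Qed.

Lemma ratio_spine (n : nat) (u : W) : fixes_bcd u ->
  ratio (spine n u) = Nat.iter n next_ratio (ratio u).
Proof.
  revert u. induction n as [|n IH]; intros u Hu; [reflexivity|].
  rewrite Nat.iter_succ_r, <- ratio_sec1 by exact Hu. apply IH, fixes_bcd_sec1, Hu.
Qed.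

(** By [next_ratioE] the new ratio is a quotient of the first-level sections of h, so each iteration
    uses up one level. *)
Lemma at_level_next_ratio (n : nat) (h : W) :
  at_level Grig n h -> Grig (Nat.iter n next_ratio h).
Proof.
  revert h. induction n as [|n IH]; intros h Hh; [exact Hh|].
  rewrite Nat.iter_succ_r. apply IH. rewrite next_ratioE.
  apply (at_level_mul Grig); [apply gen_mul| |apply at_level_sec, Hh].
  apply at_level_inv; [apply gen_inv|apply at_level_sec, Hh].
Qed.

(** Commuting with a makes the two sections equal; one of them commutes with b, c, d and the other
    with a, so coinduction applies. *)
Lemma centralizer_trivial (c : W) : fixes_bcd c -> conj ga c = ga -> c = one.
Proof.
  intros Hc Ha. apply (bisim (fun c e => fixes_bcd c /\ conj ga c = ga /\ e = one));
    [|auto].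
  clear. intros c e (Hc & Ha & ->). assert (Ac := fixes_bcd_nil c Hc).
  assert (Hr : ratio c = one) by (rewrite <- ratio_conj_ga, Ha by exact Ac; reflexivity).
  assert (H01 : sec c true = sec c false).
  { rewrite <- (mulr1 (sec c false)), <- Hr. unfold ratio. grp. }
  split; [exact Ac|].
  assert (H : fixes_bcd (sec c true) /\ conj ga (sec c true) = ga).
  { split; [now apply fixes_bcd_sec1|]. rewrite H01. now apply fixes_bcd_sec0. }
  intros []; [|rewrite <- H01]; tauto.
Qed.

(** The ratio determines the conjugate of a, so u and v conjugate all generators alike and differ by
    an element of the trivial centralizer. *)
Lemma fixes_bcd_ratio_inj (u v : W) :
  fixes_bcd u -> fixes_bcd v -> ratio u = ratio v -> u = v.
Proof.
  intros Hu Hv Hr.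
  assert (Ha : conj ga u = conj ga v).
  { assert (Au := fixes_bcd_nil u Hu). assert (Av := fixes_bcd_nil v Hv).
    apply W_ext; [now rewrite !conj_nil|now rewrite !ratio_conj_ga|].
    transitivity (inv (ratio u)); [|rewrite Hr]; unfold ratio; secs;
      rewrite ?Au, ?Av; cbn [xorb]; grp. }
  assert (H : u ** inv v = one).
  { apply centralizer_trivial.
    - intros i. rewrite <- conj_conj, Hu. rewrite <- (Hv i) at 1. apply conjK.
    - rewrite <- conj_conj, Ha. apply conjK. }
  rewrite <- (mulr1 u), <- (mulVl v), <- mulA, H. apply mul1.
Qed.

(** * Contraction of ratios on words *)

Fixpoint wsec (b : bool) (w : list letter) : list letter :=
  match w with
  | [] => []
  | None :: w => wsec (negb b) w
  | Some i :: w =>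
      (if b then [Some (bcd_next i)]
       else match i with Bd => [] | _ => [None] end) ++ wsec b w
  end.

Fixpoint wact (w : list letter) : bool :=
  match w with
  | [] => false
  | None :: w => negb (wact w)
  | Some _ :: w => wact w
  end.

Lemma weval_nil (w : list letter) : weval w [] = wact w.
Proof.
  induction w as [|[i|] w IH]; [reflexivity|..];
    rewrite weval_cons, mul_nil, IH; cbn [leval wact]; reflexivity.
Qed.

Lemma weval_wsec (w : list letter) (b : bool) : weval (wsec b w) = sec (weval w) b.
Proof.
  revert b. induction w as [|[i|] w IH]; intros b; [reflexivity|..];
    rewrite weval_cons, sec_mul; cbn [leval wsec].
  - rewrite weval_app, IH, bcd_nil. f_equal.
    destruct b; [|destruct i]; cbn [weval fold_right]; now rewrite ?mulr1.
  - rewrite IH, sec_ga, mul1. now destruct b.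
Qed.

Definition wpush (l : letter) (w : list letter) : list letter :=
  match l, w with
  | None, None :: w' => w'
  | Some Bb, Some Bb :: w' | Some Bc, Some Bc :: w' | Some Bd, Some Bd :: w' => w'
  | Some i, Some j :: w' => Some (bcd_third i j) :: w'
  | _, _ => l :: w
  end.

Definition wreduce (w : list letter) : list letter := fold_right wpush [] w.

Lemma weval_wpush (l : letter) (w : list letter) :
  weval (wpush l w) = leval l ** weval w.
Proof.
  destruct l as [i|], w as [|[j|] w]; try (destruct i; reflexivity).
  - rewrite weval_cons. cbn [leval]. rewrite <- mulA.
    destruct i, j; cbn [wpush]; rewrite ?bcdK, ?mul1, ?bcd_mul by discriminate;
      reflexivity.
  - reflexivity.
  - reflexivity.
  - rewrite weval_cons. cbn [leval wpush]. now rewrite ga_cancel.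
Qed.

Lemma weval_wreduce (w : list letter) : weval (wreduce w) = weval w.
Proof.
  induction w as [|l w IH]; [reflexivity|].
  cbn [wreduce fold_right]. fold (wreduce w). now rewrite weval_wpush, IH.
Qed.

Definition wnext (w : list letter) : list letter :=
  wreduce (rev (wsec (wact w) w) ++ wsec (negb (wact w)) w).

Lemma weval_wnext (w : list letter) : weval (wnext w) = next_ratio (weval w).
Proof.
  unfold wnext. rewrite weval_wreduce, weval_app, weval_rev, !weval_wsec, next_ratioE.
  now rewrite weval_nil.
Qed.

Fixpoint alternating (w : list letter) : bool :=
  match w with
  | [] | [_] => true
  | None :: ((Some _ :: _) as w') | Some _ :: ((None :: _) as w') => alternating w'
  | _ => false
  end.

Lemma alternating_wpush (l : letter) (w : list letter) :
  alternating w = true -> alternating (wpush l w) = true.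
Proof.
  destruct l as [i|], w as [|[j|] [|[k|] w]]; cbn; try discriminate; trivial;
    destruct i; try destruct j; cbn; trivial.
Qed.

Lemma alternating_wreduce (w : list letter) : alternating (wreduce w) = true.
Proof. induction w as [|l w IH]; [reflexivity|now apply alternating_wpush]. Qed.

(* With these weights, the two sections of a letter of {b, c, d} weigh two more than
   the letter, one less than the letter together with the a that separates it from the
   next one, while wpush does not increase the weight. *)
Definition lweight (l : letter) : nat :=
  match l with None => 3 | Some Bb => 4 | Some Bc => 3 | Some Bd => 2 end.

Fixpoint weight (w : list letter) : nat :=
  match w with [] => 0 | l :: w => lweight l + weight w end.

Lemma weight_app (v w : list letter) : weight (v ++ w) = weight v + weight w.
Proof. induction v as [|l v IH]; cbn [app weight]; lia. Qed.

Lemma weight_rev (w : list letter) : weight (rev w) = weight w.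
Proof. induction w as [|l w IH]; cbn [rev weight]; rewrite ?weight_app; cbn [weight]; lia. Qed.

Lemma weight_wpush (l : letter) (w : list letter) :
  weight (wpush l w) <= lweight l + weight w.
Proof.
  destruct l as [[]|], w as [|[[]|] w]; cbn [wpush bcd_third weight lweight]; lia.
Qed.

Lemma weight_wreduce (w : list letter) : weight (wreduce w) <= weight w.
Proof.
  induction w as [|l w IH]; [auto|]. cbn [wreduce fold_right weight].
  fold (wreduce w). assert (H := weight_wpush l (wreduce w)). lia.
Qed.

Fixpoint count_a (w : list letter) : nat :=
  match w with [] => 0 | None :: w => S (count_a w) | Some _ :: w => count_a w end.

Fixpoint count_bcd (w : list letter) : nat :=
  match w with [] => 0 | None :: w => count_bcd w | Some _ :: w => S (count_bcd w) end.

Lemma weight_wsec (w : list letter) (b : bool) :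
  weight (wsec b w) + weight (wsec (negb b) w) + 3 * count_a w
  = weight w + 2 * count_bcd w.
Proof.
  revert b. induction w as [|[i|] w IH]; intros b; [reflexivity|..].
  - specialize (IH b). cbn [wsec weight count_a count_bcd]. rewrite !weight_app.
    destruct b, i; cbn [negb bcd_next weight lweight] in *; lia.
  - specialize (IH (negb b)). cbn [wsec weight lweight count_a count_bcd]. lia.
Qed.

Lemma alternating_count (w : list letter) : alternating w = true ->
  match w with
  | [] => True
  | None :: _ => count_bcd w <= count_a w <= count_bcd w + 1
  | Some _ :: _ => count_a w <= count_bcd w <= count_a w + 1
  end.
Proof.
  induction w as [|l [|l' w] IH]; [trivial|destruct l; cbn; lia|].
  destruct l as [i|], l' as [j|]; cbn; try discriminate; intros Hw%IH; cbn in Hw; lia.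
Qed.

Lemma length_count (w : list letter) : length w = count_a w + count_bcd w.
Proof. induction w as [|[i|] w IH]; cbn; lia. Qed.

(** Passing to sections loses 3 for each a and gains 2 for each other letter, and alternation makes
    the counts differ by at most one. The weight thus drops once there are more than three letters
    b, c, d. *)
Lemma weight_wnext (w : list letter) : alternating w = true ->
  weight (wnext w) + count_bcd w <= weight w + 3.
Proof.
  intros Hw%alternating_count. unfold wnext.
  assert (H1 := weight_wreduce (rev (wsec (wact w) w) ++ wsec (negb (wact w)) w)).
  rewrite weight_app, weight_rev in H1. assert (H2 := weight_wsec w (wact w)).
  assert (count_bcd w <= count_a w + 1) by (destruct w as [|[]]; cbn in *; lia). lia.
Qed.

Fixpoint reaches (n : nat) (w : list letter) : bool :=
  match w with
  | [] | [Some Bb] => true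
  | _ => match n with 0 => false | S n => reaches n (wnext w) end
  end.

Lemma reachesP (n : nat) (w : list letter) : reaches n w = true ->
  exists m, Nat.iter m wnext w = [] \/ Nat.iter m wnext w = [Some Bb].
Proof.
  revert w. induction n as [|n IH]; intros w Hw.
  - exists 0. destruct w as [|[[]|] [|]]; try discriminate; auto.
  - assert (w = [] \/ w = [Some Bb] \/ reaches n (wnext w) = true) as [->|[->|Hn]]
      by (destruct w as [|[[]|] [|]]; auto).
    + now exists 0; left.
    + now exists 0; right.
    + destruct (IH _ Hn) as [m Hm]. exists (S m). now rewrite Nat.iter_succ_r.
Qed.

Definition letters : list letter := [None; Some Bb; Some Bc; Some Bd].

Fixpoint words (n : nat) : list (list letter) :=
  match n with
  | 0 => [[]]
  | S n => [] :: flat_map (fun l => map (cons l) (words n)) letters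
  end.

Lemma in_words (n : nat) (w : list letter) : length w <= n -> In w (words n).
Proof.
  revert w. induction n as [|n IH]; intros [|l w] Hw; cbn in Hw; [now left|lia|now left|].
  right. apply in_flat_map. exists l. split.
  - destruct l as [[]|]; cbn; tauto.
  - apply in_map, IH. lia.
Qed.

(** An alternating word with at most three letters b, c, d has at most four letters a, hence length
    at most 7. The check covers all words up to this length, alternating or not, and 20 steps
    suffice. *)
Lemma short_words_reach : forallb (reaches 20) (words 7) = true.
Proof. vm_cast_no_check (eq_refl true). Qed.

Lemma wnext_terminates (w : list letter) : alternating w = true ->
  exists m, Nat.iter m wnext w = [] \/ Nat.iter m wnext w = [Some Bb].
Proof.
  remember (weight w) as k eqn:Hk. revert w Hk.
  induction (lt_wf k) as [k _ IH]. intros w -> Hw.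
  destruct (le_lt_dec (count_bcd w) 3) as [Hc|Hc].
  - apply (reachesP 20). apply (proj1 (forallb_forall _ _) short_words_reach).
    apply in_words. rewrite length_count. apply alternating_count in Hw.
    destruct w as [|[]]; cbn in *; lia.
  - assert (Hlt : weight (wnext w) < weight w) by (assert (H := weight_wnext w Hw); lia).
    destruct (IH _ Hlt (wnext w) eq_refl (alternating_wreduce _)) as [m Hm].
    exists (S m). now rewrite Nat.iter_succ_r.
Qed.

Lemma next_ratio_terminates (h : W) : Grig h ->
  exists m, Nat.iter m next_ratio h = one \/ Nat.iter m next_ratio h = gb.
Proof.
  intros [w ->]%Grig_word.
  destruct (wnext_terminates (wreduce w) (alternating_wreduce w)) as [m Hm].
  exists m.
  replace (Nat.iter m next_ratio (weval w)) with (weval (Nat.iter m wnext (wreduce w))).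
  - destruct Hm as [-> | ->]; [now left|right]. apply mulr1.
  - rewrite <- (weval_wreduce w). generalize (wreduce w). clear. intros w.
    induction m as [|m IH]; [reflexivity|]. now rewrite !Nat.iter_succ, weval_wnext, IH.
Qed.

(** Three successive descents: to a section commuting with b, c, d, then to one whose ratio lies in
    G, then to one whose ratio is 1 or b. Injectivity of the ratio identifies the last section as 1
    or d. *)
Lemma spine_terminates (w : W) :
  (forall i, contracting (conj (bcd i) w)) ->
  (forall n, contracting (ratio (spine n w))) ->
  exists n, Grig (spine n w).
Proof.
  intros Hw Hr. destruct (fixes_bcd_of_contracting w Hw) as [n Hn].
  destruct (Hr n) as [m Hm%(at_level_mono _ Grig _ nucleus_Grig)%at_level_next_ratio].
  destruct (next_ratio_terminates _ Hm) as [l Hl].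
  rewrite <- (ratio_spine m _ Hn) in Hl.
  assert (Hnm := fixes_bcd_spine m _ Hn).
  rewrite <- (ratio_spine l _ Hnm) in Hl.
  assert (Hnml := fixes_bcd_spine l _ Hnm).
  exists (n + m + l). rewrite !spine_add.
  destruct Hl as [Hl|Hl].
  - replace (spine l (spine m (spine n w))) with one; [apply gen_one|].
    symmetry. apply fixes_bcd_ratio_inj; [assumption| |].
    + intros i. grp.
    + rewrite Hl. symmetry. apply mulVl.
  (* As d = (1, b), its ratio is b, and it commutes with b, c, d. *)
  - replace (spine l (spine m (spine n w))) with gd; [apply Grig_gd|].
    symmetry. apply fixes_bcd_ratio_inj; [assumption| |].
    + intros i. unfold conj, gd. rewrite mulA, (bcd_comm i Bd). apply mulVK.
    + rewrite Hl. unfold ratio. secs. grp.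
Qed.

Ltac splits := repeat match goal with |- _ /\ _ => split end.

(** * Normalizers of subgroups described by their sections *)

Definition wpair (g0 g1 : W) : W :=
  fun v => match v with [] => false | b :: w => if b then g1 w else g0 w end.

(** The root activity of x is left free, as the groups so described contain a. *)
Definition described (H : W -> Prop) (Q : W -> W -> Prop) : Prop :=
  forall x, H x <-> Q (sec x false) (sec x true).

Lemma pair_decomposition (x : W) :
  x = wpair (sec x false) (sec x true) ** (if x [] then ga else one).
Proof. apply W_ext; destruct (x []) eqn:Ax; secs; rewrite ?Ax; grp. Qed.

(** H is generated by a and its elements fixing the first level. The first two clauses handle these
    elements, under x and its inverse; the last clause handles the conjugate of a. *)
Lemma normalizer_described (H : W -> Prop) (Q : W -> W -> Prop) :
  subgroup H -> H ga -> described H Q ->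
  described (normalizer H) (fun x0 x1 =>
    (forall g0 g1, Q g0 g1 -> Q (conj g0 x0) (conj g1 x1)) /\
    (forall g0 g1, Q g0 g1 -> Q (conj g0 (inv x0)) (conj g1 (inv x1))) /\
    Q (inv x0 ** x1) (inv x1 ** x0)).
Proof.
  intros HS Ha HQ x.
  rewrite (pair_decomposition x) at 1.
  rewrite (sg_cancel_r _ _ _ (subgroup_normalizer H))
    by (apply (normalizer_incl _ HS); destruct (x []); [exact Ha|apply (sg1 _ HS)]).
  generalize (sec x false) (sec x true). clear x. intros x0 x1.
  assert (HP : forall u0 u1 g0 g1,
    Q (conj g0 u0) (conj g1 u1) <-> H (conj (wpair g0 g1) (wpair u0 u1))).
  { intros u0 u1 g0 g1. rewrite (HQ (conj _ _)).
    rewrite (sec_conj (wpair g0 g1) (wpair u0 u1) false eq_refl : sec (conj _ _) false = _).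
    rewrite (sec_conj (wpair g0 g1) (wpair u0 u1) true eq_refl : sec (conj _ _) true = _).
    reflexivity. }
  assert (HC : Q (inv x0 ** x1) (inv x1 ** x0) <-> H (conj ga (wpair x0 x1))).
  { rewrite (HQ (conj _ _)).
    replace (sec (conj ga (wpair x0 x1)) false) with (inv x0 ** x1)
      by (secs; cbn [wpair xorb]; change (wpair x0 x1 []) with false; secs; grp).
    replace (sec (conj ga (wpair x0 x1)) true) with (inv x1 ** x0)
      by (secs; cbn [wpair xorb]; change (wpair x0 x1 []) with false; secs; grp).
    reflexivity. }
  assert (HI : wpair (inv x0) (inv x1) = inv (wpair x0 x1)) by now apply W_ext.
  rewrite normalizerE, HC. split.
  - intros [H1 H2]. splits; [| |auto]; intros g0 g1 Hg; apply HP;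
      rewrite ?HI; [apply H1|apply H2]; now apply HQ.
  - intros (H1 & H2 & H3).
    assert (K1 : forall h, H h -> h [] = false -> H (conj h (wpair x0 x1))).
    { intros h Hh Ah. replace h with (wpair (sec h false) (sec h true))
        by (apply W_ext; [now rewrite Ah|reflexivity..]). now apply HP, H1, HQ. }
    assert (K2 : forall h, H h -> h [] = false -> H (conj h (inv (wpair x0 x1)))).
    { intros h Hh Ah. replace h with (wpair (sec h false) (sec h true))
        by (apply W_ext; [now rewrite Ah|reflexivity..]).
      rewrite <- HI. now apply HP, H2, HQ. }
    (* No separate clause is needed for the inverse on a: m fixes the first level, and conjugating
       it back yields a times the wanted conjugate. *)
    assert (K3 : H (conj ga (inv (wpair x0 x1)))).
    { set (m := conj ga (wpair x0 x1) ** ga).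
      replace (conj ga (inv (wpair x0 x1)))
        with (inv (conj m (inv (wpair x0 x1))) ** ga).
      - apply (sgM _ HS); [apply (sgV _ HS)|exact Ha].
        apply K2; [apply (sgM _ HS); assumption|].
        unfold m. now rewrite mul_nil, conj_nil.
      - unfold m. rewrite conj_mul, conjK, inv_mul, mulA. rewrite <- conj_inv, inv_ga.
        now rewrite gaK, mulr1. }
    assert (K : forall w, (forall h, H h -> h [] = false -> H (conj h w)) ->
      H (conj ga w) -> forall h, H h -> H (conj h w)).
    { intros w Kw Kg h Hh. destruct (h []) eqn:Ah; [|auto].
      replace h with ((h ** ga) ** ga) by now rewrite mulA, gaK, mulr1.
      rewrite conj_mul. apply (sgM _ HS); [|exact Kg].
      apply Kw; [now apply (sgM _ HS)|]. now rewrite mul_nil, Ah. }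
    split; apply K; assumption.
Qed.

(** * The first three normalizers *)

Lemma phi_conj (x w : W) : phi (conj x w) = dmul (dmul (dinv (phi w)) (phi x)) (phi w).
Proof. unfold conj. now rewrite !phi_mul, phi_inv. Qed.

Lemma del_conj (x w : W) : del (conj x w) = del x.
Proof.
  unfold conj. rewrite !del_mul, del_inv. destruct (del x), (del w); reflexivity.
Qed.

Lemma chi_conj (x w : W) : chi (conj x w) = chi x.
Proof. unfold chi. now rewrite conj_nil, del_conj. Qed.

Local Notation N1 := (normalizer Grig).

Lemma N1_subgroup : subgroup N1.
Proof. apply subgroup_normalizer. Qed.

Lemma Grig_N1 (x : W) : Grig x -> N1 x.
Proof. apply normalizer_incl, Grig_subgroup. Qed.

Lemma Grig_described :
  described Grig (fun g0 g1 => Grig g0 /\ Grig g1 /\ phi g1 = dswap (phi g0)).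
Proof. exact GrigE. Qed.

(** Exchange of the images under [phi] modulo the centre of D8, on which only the corner entry
    varies. *)
Definition swapped (x0 x1 : W) : Prop := x1 [] = del x0 /\ del x1 = x0 [].

Lemma swapped_phi (x0 x1 : W) : swapped x0 x1 <->
  phi x1 = dswap (phi x0) \/ phi x1 = dmul (false, false, true) (dswap (phi x0)).
Proof.
  unfold swapped, phi. destruct (x0 []), (x1 []), (del x0), (del x1), (kap x0), (kap x1);
    cbn; split; intros H; try destruct H; try congruence; auto.
Qed.

(** A central factor cancels under conjugation, so an exchange modulo the centre suffices. *)
Lemma swapped_central (s0 t0 s1 t1 : D8) :
  t0 = dswap s0 ->
  t1 = dswap s1 \/ t1 = dmul (false, false, true) (dswap s1) ->
  dmul (dmul (dinv t1) t0) t1 = dswap (dmul (dmul (dinv s1) s0) s1).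
Proof.
  intros -> [-> | ->].
  - now rewrite !dswap_mul, dswap_inv.
  - destruct s0 as [[[] []] []], s1 as [[[] []] []]; reflexivity.
Qed.

Lemma swapped_ratio (s t : D8) :
  t = dswap s \/ t = dmul (false, false, true) (dswap s) ->
  dmul (dinv t) s = dswap (dmul (dinv s) t).
Proof. intros [-> | ->]; d8. Qed.

Lemma N1_described : described N1 (fun x0 x1 =>
  N1 x0 /\ N1 x1 /\ Grig (inv x0 ** x1) /\ swapped x0 x1).
Proof.
  intros x. rewrite (normalizer_described _ _ Grig_subgroup Grig_ga Grig_described x).
  generalize (sec x false) (sec x true). clear x. intros x0 x1. split.
  - intros (HA & HB & HC & _).
    split; [|split; [|split; [exact HC|split]]]; [apply normalizerE; split..| |].
    + intros h (y & Hy & _ & <-)%Grig_lift. now apply (HA _ (sec y true)), GrigE.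
    + intros h (y & Hy & _ & <-)%Grig_lift. now apply (HB _ (sec y true)), GrigE.
    + intros h (y & Hy & _ & <-)%Grig_lift1. now apply (HA (sec y false)), GrigE.
    + intros h (y & Hy & _ & <-)%Grig_lift1. now apply (HB (sec y false)), GrigE.
    (* The test pairs (a, d) and (d, a) are the sections of c and of its conjugate by a. *)
    + destruct (HA ga gd) as (_ & _ & H1);
        [splits; [apply Grig_ga|apply Grig_gd|reflexivity]|].
      destruct (HA gd ga) as (_ & _ & H2);
        [splits; [apply Grig_gd|apply Grig_ga|reflexivity]|].
      rewrite !phi_conj, phi_ga, phi_gd in H1, H2. unfold phi in H1, H2.
      destruct (x0 []), (x1 []), (del x0), (del x1), (kap x0), (kap x1);
        first [reflexivity|discriminate].
    + destruct (HA ga gd) as (_ & _ & H1);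
        [splits; [apply Grig_ga|apply Grig_gd|reflexivity]|].
      destruct (HA gd ga) as (_ & _ & H2);
        [splits; [apply Grig_gd|apply Grig_ga|reflexivity]|].
      rewrite !phi_conj, phi_ga, phi_gd in H1, H2. unfold phi in H1, H2.
      destruct (x0 []), (x1 []), (del x0), (del x1), (kap x0), (kap x1);
        first [reflexivity|discriminate].
  - intros (H0 & H1 & HG & Hs).
    assert (K : forall u0 u1, N1 u0 -> N1 u1 -> swapped u0 u1 -> forall g0 g1,
      Grig g0 /\ Grig g1 /\ phi g1 = dswap (phi g0) ->
      Grig (conj g0 u0) /\ Grig (conj g1 u1) /\
      phi (conj g1 u1) = dswap (phi (conj g0 u0))).
    { intros u0 u1 Hu0 Hu1 Hu%swapped_phi g0 g1 (G0 & G1 & Hg).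
      splits; [now apply (normalizer_conj Grig)..|].
      rewrite !phi_conj. now apply swapped_central. }
    split; [|split].
    + apply K; assumption.
    + apply K; [now apply (sgV _ N1_subgroup)..|].
      unfold swapped. now rewrite !inv_nil, !del_inv.
    + split; [exact HG|]. split.
      * replace (inv x1 ** x0) with (inv (inv x0 ** x1)) by grp.
        now apply gen_inv.
      * rewrite !phi_mul, !phi_inv. now apply swapped_ratio, swapped_phi.
Qed.

(** * Generators of the first normalizer *)

Definition Dp (k : nat) : W := Nat.iter k Delta p_el.

Definition N1gen : W -> Prop := gen (fun y => is_gen_abcd y \/ exists k, y = Dp k).

Lemma p_el_adad : p_el = Pi (Delta gb).
Proof. unfold p_el. now rewrite adad. Qed.

Lemma del_Delta (x : W) : del (Delta x) = false.
Proof.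
  unfold del, lev2. rewrite !sec_Delta. unfold lev1 at 1.
  change (xorb (xorb (x []) (x [])) (xorb (lev1 x) (lev1 x)) = false).
  now rewrite !xorb_nilpotent.
Qed.

Lemma del_Dp (k : nat) : del (Dp k) = false.
Proof. destruct k as [|k]; [reflexivity|apply del_Delta]. Qed.

Lemma Dp_nil (k : nat) : Dp k [] = false.
Proof. destruct k as [|k]; reflexivity. Qed.

Lemma Grig_Delta_gb : Grig (Delta gb).
Proof.
  rewrite <- adad.
  repeat first [apply Grig_ga|apply Grig_gd|apply (sgM _ Grig_subgroup)].
Qed.

Lemma N1_Delta (x : W) : N1 x -> x [] = false -> del x = false -> N1 (Delta x).
Proof.
  intros Hx Ax Dx. apply N1_described. rewrite !sec_Delta, mulVl.
  unfold swapped. rewrite Ax, Dx. splits; auto. apply gen_one.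
Qed.

Lemma N1_Dp (k : nat) : N1 (Dp k).
Proof.
  induction k as [|k IH]; [|apply N1_Delta; [exact IH|apply Dp_nil|apply del_Dp]].
  change (Dp 0) with p_el. rewrite p_el_adad. apply N1_described.
  rewrite sec_Pi0, sec_Pi1. split; [|split; [|split]].
  - apply Grig_N1, gen_one.
  - apply Grig_N1, Grig_Delta_gb.
  - apply gen_mul; [apply gen_inv, gen_one|apply Grig_Delta_gb].
  - split; reflexivity.
Qed.

Lemma N1gen_N1 (x : W) : N1gen x -> N1 x.
Proof.
  apply gen_sub; [apply N1_subgroup|]. intros y [Hy|[k ->]]; [|apply N1_Dp].
  now apply Grig_N1, gen_base.
Qed.

Definition Dps : W -> Prop := gen (fun y => exists k, y = Dp k).

Lemma N1gen_decomposition (x : W) : N1gen x ->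
  exists s g, Dps s /\ Grig g /\ x = s ** g.
Proof.
  assert (HN : forall s, Dps s -> N1 s).
  { apply gen_sub; [apply N1_subgroup|]. intros y [k ->]. apply N1_Dp. }
  intros Hx. induction Hx as [x [Hx|[k ->]]| |x y _ (s & g & Hs & Hg & ->) _
    (s' & g' & Hs' & Hg' & ->)|x _ (s & g & Hs & Hg & ->)].
  - exists one, x. splits; [apply gen_one|now apply gen_base|grp].
  - exists (Dp k), one. splits; [apply gen_base; eauto|apply gen_one|grp].
  - exists one, one. splits; [apply gen_one..|grp].
  - exists (s ** s'), (conj g s' ** g'). splits; [now apply gen_mul| |grp].
    apply gen_mul; [|exact Hg']. now apply (normalizer_conj Grig); auto.
  - exists (inv s), (conj (inv g) (inv s)). splits; [now apply gen_inv| |grp].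
    apply (normalizer_conj Grig); [now apply HN, gen_inv|now apply gen_inv].
Qed.

Lemma Dps_bits (s : W) : Dps s -> s [] = false /\ del s = false.
Proof.
  intros Hs. induction Hs as [x [k ->]| |x y _ [X X'] _ [Y Y']|x _ [X X']].
  - split; [apply Dp_nil|apply del_Dp].
  - split; reflexivity.
  - now rewrite mul_nil, del_mul, X, X', Y, Y'.
  - now rewrite inv_nil, del_inv.
Qed.

Lemma Grig_Delta (g : W) : Grig g -> g [] = false -> del g = false -> Grig (Delta g).
Proof.
  intros Hg Ag Dg. apply GrigE. rewrite !sec_Delta. splits; [assumption..|].
  unfold phi. rewrite Ag, Dg. cbn. now rewrite xorb_false_r.
Qed.

(** On the factor from [Dps], Delta shifts the generators [Dp k]; the factor from G has central
    image under [phi], fixed by [dswap], so [Grig_Delta] applies. *)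
Lemma N1gen_Delta (t : W) : N1gen t -> t [] = false -> del t = false ->
  N1gen (Delta t).
Proof.
  intros (s & g & Hs & Hg & ->)%N1gen_decomposition. destruct (Dps_bits s Hs) as [As Ds].
  rewrite mul_nil, del_mul, As, Ds, Delta_mul, !xorb_false_l. intros Ag Dg.
  apply gen_mul.
  - clear As Ds. revert s Hs.
    apply (gen_sub _ (fun x => N1gen (Delta x))); [apply (subgroup_Delta N1gen), subgroup_gen|].
    intros y [k ->]. apply gen_base. right. now exists (S k).
  - apply (gen_mono is_gen_abcd); [|now apply Grig_Delta].
    intros x Hx. apply gen_base. now left.
Qed.

Lemma Grig_N1gen (g : W) : Grig g -> N1gen g.
Proof. apply gen_mono. intros x Hx. apply gen_base. now left. Qed.

Lemma Grig_with_bits (i j : bool) : exists e, Grig e /\ e [] = i /\ del e = j.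
Proof.
  exists ((if i then ga else one) ** (if j then gd else one)). split; [|split].
  - apply gen_mul; [destruct i|destruct j];
      first [apply Grig_ga|apply Grig_gd|apply gen_one].
  - destruct i, j; reflexivity.
  - destruct i, j; reflexivity.
Qed.

(** After division by a suitable Delta t, where t is the section at 1 corrected by an element e of G
    to have zero bits, both sections lie in G. The rest is then in G, or becomes so after
    multiplication by p. *)
Lemma N1gen_of_sec1 (w : W) : N1 w -> N1gen (sec w true) -> N1gen w.
Proof.
  intros Hw H1. destruct (proj1 (N1_described w) Hw) as (_ & _ & HG & _).
  destruct (Grig_with_bits (sec w true []) (del (sec w true))) as (e & He & Ae & De).
  set (t := sec w true ** inv e).
  assert (Ht : N1gen (Delta t)).
  { apply N1gen_Delta; unfold t.
    - apply gen_mul; [exact H1|apply gen_inv, Grig_N1gen, He].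
    - rewrite mul_nil, inv_nil, Ae. apply xorb_nilpotent.
    - rewrite del_mul, del_inv, De. apply xorb_nilpotent. }
  set (y := inv (Delta t) ** w).
  assert (Ey0 : sec y false = e ** inv (inv (sec w false) ** sec w true))
    by (unfold y, t; secs; grp).
  assert (Ey1 : sec y true = e) by (unfold y, t; secs; grp).
  assert (Hy : N1 y).
  { apply (sgM _ N1_subgroup); [apply (sgV _ N1_subgroup), N1gen_N1, Ht|exact Hw]. }
  destruct (proj1 (N1_described y) Hy) as (_ & _ & _ & Hs%swapped_phi).
  assert (Y0 : Grig (sec y false)).
  { rewrite Ey0. apply gen_mul; [exact He|now apply gen_inv]. }
  assert (Y1 : Grig (sec y true)) by now rewrite Ey1.
  replace w with (Delta t ** y) by (unfold y; grp).
  apply gen_mul; [exact Ht|]. destruct Hs as [Hs|Hs].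
  - now apply Grig_N1gen, GrigE.
  (* As p = (1, (b, b)) and (b, b) maps to the nontrivial central element of D8, p removes the
     central discrepancy. *)
  - replace y with (inv (Dp 0) ** (Dp 0 ** y)) by grp.
    apply gen_mul; [apply gen_inv, gen_base; right; now exists 0|].
    apply Grig_N1gen, GrigE. rewrite !sec_mul, Dp_nil.
    change (Dp 0) with p_el. rewrite p_el_adad, sec_Pi0, sec_Pi1, mul1. cbn [xorb].
    splits; [exact Y0|apply gen_mul; [apply Grig_Delta_gb|exact Y1]|].
    rewrite phi_mul, Hs, <- dmulA. change (dmul (phi (Delta gb)) (false, false, true)) with dunit.
    generalize (dswap (phi (sec y false))). intros s. d8.
Qed.

(** Far along the spine a section lies in G; [N1gen_of_sec1] climbs back to w. *)
Lemma N1_N1gen (w : W) : N1 w <-> N1gen w.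
Proof.
  split; [|apply N1gen_N1]. intros Hw.
  assert (HS : forall n, N1 (spine n w)).
  { intros n. revert w Hw. induction n as [|n IH]; [auto|]. intros w Hw.
    apply IH. now apply N1_described in Hw. }
  destruct (spine_terminates w) as [n Hn].
  - intros i. apply contracting_Grig, (normalizer_conj Grig); [exact Hw|apply Grig_bcd].
  - intros n. apply contracting_Grig. now apply N1_described.
  - apply Grig_N1gen in Hn. clear HS. revert w Hw Hn.
    induction n as [|n IH]; [auto|]. intros w Hw Hn.
    apply N1gen_of_sec1; [exact Hw|]. apply IH; [now apply N1_described in Hw|exact Hn].
Qed.

(** * Commutators and squares in the first normalizer *)

Definition comm (x y : W) : W := inv x ** conj x y.

Lemma comm_inv (x y : W) : inv (comm x y) = comm y x.
Proof. unfold comm. grp. Qed.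

Lemma comm_subgroup_l (A : W -> Prop) (y : W) : subgroup A ->
  subgroup (fun x => normalizer A x /\ A (comm x y)).
Proof.
  intros HA. assert (HN := subgroup_normalizer A). split.
  - split; [apply (sg1 _ HN)|]. replace (comm one y) with one by (unfold comm; grp).
    apply (sg1 _ HA).
  - intros u v [Hu Hu'] [Hv Hv']. split; [now apply (sgM _ HN)|].
    replace (comm (u ** v) y) with (conj (comm u y) v ** comm v y) by (unfold comm; grp).
    apply (sgM _ HA); [|exact Hv']. now apply normalizer_conj.
  - intros u [Hu Hu']. split; [now apply (sgV _ HN)|].
    replace (comm (inv u) y) with (conj (inv (comm u y)) (inv u)) by (unfold comm; grp).
    apply normalizer_conj; [now apply (sgV _ HN)|now apply (sgV _ HA)].
Qed.

(** Modulo A the generators commute and have trivial squares. *)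
Lemma exponent2_gen (A S : W -> Prop) : subgroup A ->
  (forall s, S s -> normalizer A s) ->
  (forall s t, S s -> S t -> A (comm s t)) -> (forall s, S s -> A (s ** s)) ->
  forall x, gen S x -> A (x ** x).
Proof.
  intros HA HN HC H2.
  assert (C1 : forall x, gen S x -> forall t, S t -> A (comm x t)).
  { intros x Hx t Ht. revert x Hx.
    assert (K : forall x, gen S x -> normalizer A x /\ A (comm x t)).
    { apply gen_sub; [apply comm_subgroup_l, HA|]. auto. }
    intros x Hx. apply (K x Hx). }
  assert (C2 : forall x, gen S x -> forall y, gen S y -> A (comm x y)).
  { intros x Hx y Hy. rewrite <- comm_inv. apply (sgV _ HA).
    apply (gen_sub S (fun y => normalizer A y /\ A (comm y x))); [|clear y Hy|exact Hy].
    - apply comm_subgroup_l, HA.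
    - intros y Hy. split; [auto|]. rewrite <- comm_inv. apply (sgV _ HA). auto. }
  intros x Hx. induction Hx as [x Hx| |x y Hx IHx Hy IHy|x Hx IHx].
  - auto.
  - rewrite mul1. apply (sg1 _ HA).
  - replace ((x ** y) ** (x ** y)) with ((x ** x) ** comm x (inv y) ** (y ** y))
      by (unfold comm; grp).
    apply (sgM _ HA); [|exact IHy]. apply (sgM _ HA); [exact IHx|].
    apply C2; [exact Hx|now apply gen_inv].
  - rewrite <- inv_mul. now apply (sgV _ HA).
Qed.

Lemma comm_nil (x y : W) : comm x y [] = false.
Proof. unfold comm. rewrite mul_nil, inv_nil, conj_nil. apply xorb_nilpotent. Qed.

Lemma del_comm (x y : W) : del (comm x y) = false.
Proof. unfold comm. rewrite del_mul, del_inv, del_conj. apply xorb_nilpotent. Qed.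

Lemma Delta_conj (x w : W) : Delta (conj x w) = conj (Delta x) (Delta w).
Proof. unfold conj. now rewrite !Delta_mul, Delta_inv. Qed.

Lemma Delta_comm (x y : W) : Delta (comm x y) = comm (Delta x) (Delta y).
Proof. unfold comm. now rewrite Delta_mul, Delta_inv, Delta_conj. Qed.

(** For k > 0 the commutator is Pi of the commutator of (b, b) with [Dp (k - 1)]. The latter
    normalizes G and has central image under [phi], so the inner commutator lies in the kernel of
    [phi] on G. *)
Lemma Grig_comm_p_Dp (k : nat) : Grig (comm p_el (Dp k)).
Proof.
  destruct k as [|k].
  - replace (comm p_el (Dp 0)) with one by (unfold comm; change (Dp 0) with p_el; grp).
    apply gen_one.
  - replace (comm p_el (Dp (S k))) with (Pi (comm (Delta gb) (Dp k))).
    + apply Grig_Pi_ker.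
      * unfold comm. apply gen_mul; [apply gen_inv, Grig_Delta_gb|].
        apply (normalizer_conj Grig); [apply N1_Dp|apply Grig_Delta_gb].
      * unfold comm. rewrite phi_mul, phi_inv, phi_conj.
        assert (H : phi (Dp k) = (false, false, kap (Dp k)))
          by (unfold phi; now rewrite Dp_nil, del_Dp).
        rewrite H. destruct (kap (Dp k)); reflexivity.
    + rewrite p_el_adad. change (Dp (S k)) with (Delta (Dp k)). unfold comm.
      apply W_ext; [reflexivity|secs; grp|secs; grp].
Qed.

Lemma Grig_comm_Dp (j k : nat) : Grig (comm (Dp j) (Dp k)).
Proof.
  assert (H : forall m j, Grig (comm (Dp j) (Dp (j + m)))).
  { intros m i. induction i as [|i IH]; [apply Grig_comm_p_Dp|].
    change (Grig (comm (Delta (Dp i)) (Delta (Dp (i + m))))). rewrite <- Delta_comm.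
    apply Grig_Delta; [exact IH|apply comm_nil|apply del_comm]. }
  destruct (le_ge_dec j k) as [Hjk|Hjk].
  - replace k with (j + (k - j)) by lia. apply H.
  - rewrite <- comm_inv. apply gen_inv. replace j with (k + (j - k)) by lia. apply H.
Qed.

Lemma DpK (k : nat) : Dp k ** Dp k = one.
Proof.
  induction k as [|k IH].
  - change (Dp 0) with p_el. rewrite p_el_adad, <- Pi_mul, <- Delta_mul.
    unfold gb. now rewrite bcdK, Delta_one, Pi_one.
  - change (Dp (S k)) with (Delta (Dp k)). now rewrite <- Delta_mul, IH, Delta_one.
Qed.

Lemma N1_exponent2 (x : W) : N1 x -> Grig (x ** x).
Proof.
  rewrite N1_N1gen. intros (s & g & Hs & Hg & ->)%N1gen_decomposition.
  replace ((s ** g) ** (s ** g)) with ((s ** s) ** (conj g s ** g)) by grp.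
  apply gen_mul; [|apply gen_mul; [|exact Hg]].
  - revert s Hs. apply (exponent2_gen _ _ Grig_subgroup).
    + intros s [k ->]. apply N1_Dp.
    + intros s t [j ->] [k ->]. apply Grig_comm_Dp.
    + intros s [k ->]. rewrite DpK. apply gen_one.
  - apply (normalizer_conj Grig); [|exact Hg].
    revert s Hs. apply gen_sub; [apply N1_subgroup|]. intros s [k ->]. apply N1_Dp.
Qed.

Lemma N1_comm (x y : W) : N1 x -> N1 y -> Grig ((x ** y) ** (inv x ** inv y)).
Proof.
  apply (exponent2_comm _ _ Grig_subgroup N1_subgroup); [auto|apply N1_exponent2].
Qed.

(** * The second and third normalizers *)

Local Notation N2 := (normalizer N1).
Local Notation N3 := (normalizer N2).

(** Here d = (1, b) is compared with (b, b): a conjugate of b has trivial image under [phi], so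
    [GrigE] lets it be paired with 1. *)
Lemma Grig_conj_gd (y : W) : Grig (conj (Delta gb) y) -> Grig (conj gd y).
Proof.
  intros Hy%Grig_sections.
  assert (H1 : Grig (conj gb (sec y true))).
  { change gb with (sec (Delta gb) true). rewrite <- sec_conj by reflexivity.
    destruct (xorb (y []) true); tauto. }
  assert (H2 : phi (conj gb (sec y true)) = dunit).
  { rewrite phi_conj, phi_gb. generalize (phi (sec y true)). intros s. d8. }
  assert (E1 := sec_conj gd y true eq_refl). change (sec gd true) with gb in E1.
  assert (E0 := sec_conj gd y false eq_refl). change (sec gd false) with one in E0.
  assert (E : conj one (sec y false) = one) by grp. rewrite E in E0.
  apply GrigE. destruct (y []); cbn [xorb] in E0, E1; rewrite E0, E1, H2;
    splits; trivial; apply gen_one.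
Qed.

Lemma N2_described : described N2 (fun x0 x1 => N1 x0 /\ N1 x1 /\ chi x0 = chi x1).
Proof.
  intros x.
  rewrite (normalizer_described _ _ N1_subgroup (Grig_N1 _ Grig_ga) N1_described x).
  generalize (sec x false) (sec x true). clear x. intros x0 x1.
  set (Q := fun g0 g1 => N1 g0 /\ N1 g1 /\ Grig (inv g0 ** g1) /\ swapped g0 g1).
  split.
  - assert (K : forall u0 u1,
      (forall g0 g1, Q g0 g1 -> Q (conj g0 u0) (conj g1 u1)) ->
      forall g, Grig g -> Grig (conj g u0) /\ Grig (conj g u1)).
    { intros u0 u1 HQ.
      (* An element of G with zero bits can be paired with 1, and the ratio condition then isolates
         its conjugate. Both b and (b, b) are of this kind. *)
      assert (HZ : forall n, Grig n -> n [] = false -> del n = false ->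
        Grig (conj n u0) /\ Grig (conj n u1)).
      { intros n Hn An Dn. split.
        - destruct (HQ n one) as (_ & _ & H & _).
          + unfold Q, swapped. rewrite An, Dn.
            splits; try reflexivity; try (apply Grig_N1; assumption || apply gen_one).
            rewrite mulr1. now apply gen_inv.
          + replace (conj one u1) with one in H by grp. rewrite mulr1 in H.
            rewrite <- (inv_inv (conj n u0)). now apply gen_inv.
        - destruct (HQ one n) as (_ & _ & H & _).
          + unfold Q, swapped. rewrite An, Dn.
            splits; try reflexivity; try (apply Grig_N1; assumption || apply gen_one).
            now rewrite inv_one, mul1.
          + replace (conj one u0) with one in H by grp.
            now rewrite inv_one, mul1 in H. }
      destruct (HZ gb Grig_gb eq_refl eq_refl) as [B0 B1].
      destruct (HZ _ Grig_Delta_gb eq_refl eq_refl) as [D0%Grig_conj_gd D1%Grig_conj_gd].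
      (* For a, the pair (a, d) is used: the conjugate of d is already known to lie in G. *)
      assert (A0 : Grig (conj ga u0)).
      { destruct (HQ ga gd) as (_ & _ & H & _).
        - exact (proj1 (N1_described gc) (Grig_N1 _ Grig_gc)).
        - apply (proj1 (sg_cancel_r _ _ _ Grig_subgroup D1)) in H.
          rewrite <- (inv_inv (conj ga u0)). now apply gen_inv. }
      assert (A1 : Grig (conj ga u1)).
      { destruct (HQ gd ga) as (_ & _ & H & _).
        - assert (Hc : Grig (conj gc ga))
            by (apply (sgJ _ Grig_subgroup); [apply Grig_gc|apply Grig_ga]).
          assert (H := proj1 (N1_described _) (Grig_N1 _ Hc)).
          replace (sec (conj gc ga) false) with gd in H by (secs; grp).
          replace (sec (conj gc ga) true) with ga in H by (secs; grp). exact H.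
        - exact (proj1 (sg_cancel_l _ _ _ Grig_subgroup (gen_inv _ _ D0)) H). }
      assert (Ec : gc = gb ** gd) by (symmetry; apply (bcd_mul Bb Bd); discriminate).
      assert (HS : forall u, subgroup (fun g => Grig (conj g u))).
      { intros u. split.
        - replace (conj one u) with one by grp. apply gen_one.
        - intros g h Hg Hh. rewrite conj_mul. now apply gen_mul.
        - intros g Hg. rewrite conj_inv. now apply gen_inv. }
      intros g Hg. split; revert g Hg.
      - apply (gen_sub _ (fun g => Grig (conj g u0))); [apply HS|].
        intros g [->|[->|[->| ->]]]; rewrite ?Ec, ?conj_mul; auto. now apply gen_mul.
      - apply (gen_sub _ (fun g => Grig (conj g u1))); [apply HS|].
        intros g [->|[->|[->| ->]]]; rewrite ?Ec, ?conj_mul; auto. now apply gen_mul. }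
    intros (HA & HB & (_ & _ & _ & HC & _)).
    split; [|split].
    + apply normalizerE. split; intros g Hg; [apply (K _ _ HA g Hg)|apply (K _ _ HB g Hg)].
    + apply normalizerE. split; intros g Hg; [apply (K _ _ HA g Hg)|apply (K _ _ HB g Hg)].
    + rewrite mul_nil, del_mul, inv_nil, del_inv in HC. unfold chi.
      destruct (x0 []), (x1 []), (del x0), (del x1); auto.
  - intros (H0 & H1 & Hchi).
    assert (K : forall u0 u1, N1 u0 -> N1 u1 ->
      forall g0 g1, Q g0 g1 -> Q (conj g0 u0) (conj g1 u1)).
    { intros u0 u1 Hu0 Hu1 g0 g1 (G0 & G1 & HG & Hs).
      split; [now apply (sgJ _ N1_subgroup)|]. split; [now apply (sgJ _ N1_subgroup)|].
      split; [|unfold swapped; now rewrite !conj_nil, !del_conj].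
      (* The new ratio is a conjugate of the old one times a conjugate of a commutator of elements
         of N1, which lies in G. *)
      replace (inv (conj g0 u0) ** conj g1 u1) with
        (conj ((inv g0 ** (u0 ** inv u1)) ** (inv (inv g0) ** inv (u0 ** inv u1))) u0
         ** conj (inv g0 ** g1) u1) by grp.
      apply gen_mul; [|now apply (normalizer_conj Grig)].
      apply (normalizer_conj Grig); [exact Hu0|].
      apply N1_comm; sgp N1_subgroup. }
    assert (Hk : N1 (inv x0 ** x1)) by sgp N1_subgroup.
    split; [now apply K|]. split; [apply K; now apply (sgV _ N1_subgroup)|].
    split; [exact Hk|]. split; [sgp N1_subgroup|]. split.
    + replace (inv (inv x0 ** x1) ** (inv x1 ** x0))
        with (inv ((inv x0 ** x1) ** (inv x0 ** x1))) by grp.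
      now apply gen_inv, N1_exponent2.
    + unfold swapped, chi in *. rewrite !mul_nil, !del_mul, !inv_nil, !del_inv.
      destruct (x0 []), (x1 []), (del x0), (del x1); try discriminate; split; reflexivity.
Qed.

Lemma sec_square (x : W) (b : bool) :
  sec (x ** x) b = if x [] then sec x b ** sec x (negb b) else sec x b ** sec x b.
Proof. rewrite sec_mul. destruct (x []), b; reflexivity. Qed.

Lemma chi_square (x : W) : chi (x ** x) = false.
Proof. rewrite chi_mul. apply xorb_nilpotent. Qed.

Lemma del_square (x : W) : del (x ** x) = false.
Proof. rewrite del_mul. apply xorb_nilpotent. Qed.

Lemma square_nil (x : W) : (x ** x) [] = false.
Proof. rewrite mul_nil. apply xorb_nilpotent. Qed.

(** If x exchanges the subtrees, its square has sections x0 x1 and x1 x0: their ratio is a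
    commutator in N1, and equality of [chi] gives the exchange of bits. Otherwise the sections are
    squares of elements of N1. *)
Lemma N2_exponent2 (x : W) : N2 x -> N1 (x ** x).
Proof.
  rewrite (N2_described x), (N1_described (x ** x)), !sec_square; cbn [negb].
  generalize (sec x false) (sec x true). intros x0 x1 (H0 & H1 & Hchi).
  destruct (x []); (split; [sgp N1_subgroup|]); (split; [sgp N1_subgroup|]); split.
  - replace (inv (x0 ** x1) ** (x1 ** x0))
      with ((inv x1 ** inv x0) ** (inv (inv x1) ** inv (inv x0))) by grp.
    apply N1_comm; sgp N1_subgroup.
  - unfold swapped, chi in *. rewrite !mul_nil, !del_mul.
    destruct (x0 []), (x1 []), (del x0), (del x1); try discriminate; split; reflexivity.
  - apply gen_mul; [apply gen_inv|]; now apply N1_exponent2.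
  - unfold swapped. now rewrite !square_nil, !del_square.
Qed.

Lemma N2_subgroup : subgroup N2.
Proof. apply subgroup_normalizer. Qed.

Lemma N1_N2 (x : W) : N1 x -> N2 x.
Proof. apply normalizer_incl, N1_subgroup. Qed.

Lemma N3_described : described N3 (fun x0 x1 => N2 x0 /\ N2 x1 /\ N1 (inv x0 ** x1)).
Proof.
  intros x.
  rewrite (normalizer_described _ _ N2_subgroup (N1_N2 _ (Grig_N1 _ Grig_ga)) N2_described x).
  generalize (sec x false) (sec x true). clear x. intros x0 x1. split.
  - intros (HA & HB & HC & _). split; [|split; [|exact HC]]; apply normalizerE;
      split; intros g Hg; [apply (HA g g)|apply (HB g g)|apply (HA g g)|apply (HB g g)];
      auto.
  - intros (H0 & H1 & Hk). split; [|split].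
    + intros g0 g1 (G0 & G1 & Hg). rewrite !chi_conj.
      splits; auto; now apply normalizer_conj.
    + intros g0 g1 (G0 & G1 & Hg). rewrite !chi_conj.
      splits; auto; apply normalizer_conj; auto; now apply (sgV _ N2_subgroup).
    + split; [exact Hk|]. split.
      * replace (inv x1 ** x0) with (inv (inv x0 ** x1)) by grp. sgp N1_subgroup.
      * rewrite !chi_mul, !chi_inv. apply xorb_comm.
Qed.

Lemma N3_exponent2 (x : W) : N3 x -> N2 (x ** x).
Proof.
  rewrite (N3_described x), (N2_described (x ** x)), !sec_square; cbn [negb].
  generalize (sec x false) (sec x true). intros x0 x1 (H0 & H1 & Hk).
  destruct (x []); split; [|split| |split].
  - replace (x0 ** x1) with ((x0 ** x0) ** (inv x0 ** x1)) by grp.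
    apply (sgM _ N1_subgroup); [now apply N2_exponent2|exact Hk].
  - replace (x1 ** x0) with ((x1 ** x1) ** inv (inv x0 ** x1)) by grp.
    apply (sgM _ N1_subgroup); [now apply N2_exponent2|now apply (sgV _ N1_subgroup)].
  - rewrite !chi_mul. apply xorb_comm.
  - now apply N2_exponent2.
  - now apply N2_exponent2.
  - now rewrite !chi_square.
Qed.

(** * The higher normalizers *)

(** The conditions on pairs decouple, and only the conjugate of a links the two sections. This also
    applies to [Gstar]. *)
Lemma normalizer_wreath (A H : W -> Prop) : subgroup A -> subgroup H -> H ga ->
  described H (fun g0 g1 => A g0 /\ A g1) ->
  described (normalizer H)
    (fun x0 x1 => normalizer A x0 /\ normalizer A x1 /\ A (inv x0 ** x1)).
Proof.
  intros HA HS Ha HQ x. rewrite (normalizer_described _ _ HS Ha HQ x).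
  generalize (sec x false) (sec x true). clear x. intros x0 x1. split.
  - intros (H1 & H2 & H3 & _). split; [|split; [|exact H3]];
      apply normalizerE; split; intros g Hg;
      [apply (H1 g g)|apply (H2 g g)|apply (H1 g g)|apply (H2 g g)]; auto.
  - intros (H0 & H1 & Hk). assert (HN := subgroup_normalizer A). splits.
    + intros g0 g1 [G0 G1]. split; now apply normalizer_conj.
    + intros g0 g1 [G0 G1]. split; apply normalizer_conj; auto; now apply (sgV _ HN).
    + exact Hk.
    + replace (inv x1 ** x0) with (inv (inv x0 ** x1)) by grp. now apply (sgV _ HA).
Qed.

(** The pairs (n, 1) and (1, n) with n in A force both sections to normalize A. Conversely, the
    quotient by A has exponent two, hence is abelian, so conjugation preserves the ratio
    condition. *)
Lemma normalizer_twisted (A B : W -> Prop) : subgroup A -> subgroup B -> B ga ->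
  (forall x, normalizer A x -> A (x ** x)) ->
  described B (fun g0 g1 => normalizer A g0 /\ normalizer A g1 /\ A (inv g0 ** g1)) ->
  described (normalizer B) (fun x0 x1 => normalizer A x0 /\ normalizer A x1).
Proof.
  intros HA HS Ha H2 HQ x. rewrite (normalizer_described _ _ HS Ha HQ x).
  generalize (sec x false) (sec x true). clear x. intros x0 x1.
  assert (HN := subgroup_normalizer A). assert (Hinc := normalizer_incl A HA). split.
  - assert (K : forall u0 u1, (forall g0 g1,
        normalizer A g0 /\ normalizer A g1 /\ A (inv g0 ** g1) ->
        normalizer A (conj g0 u0) /\ normalizer A (conj g1 u1) /\
        A (inv (conj g0 u0) ** conj g1 u1)) ->
      forall n, A n -> A (conj n u0) /\ A (conj n u1)).
    { intros u0 u1 HK n Hn. split.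
      - destruct (HK n one) as (_ & _ & H).
        + splits; [now apply Hinc|apply (sg1 _ HN)|]. rewrite mulr1. now apply (sgV _ HA).
        + replace (conj one u1) with one in H by grp. rewrite mulr1 in H.
          rewrite <- (inv_inv (conj n u0)). now apply (sgV _ HA).
      - destruct (HK one n) as (_ & _ & H).
        + splits; [apply (sg1 _ HN)|now apply Hinc|]. now rewrite inv_one, mul1.
        + replace (conj one u0) with one in H by grp.
          now rewrite inv_one, mul1 in H. }
    intros (H3 & H4 & _). split; apply normalizerE; split; intros g Hg;
      [apply (K _ _ H3 g Hg)|apply (K _ _ H4 g Hg)|apply (K _ _ H3 g Hg)|
       apply (K _ _ H4 g Hg)].
  - intros [H0 H1].
    assert (K : forall u0 u1, normalizer A u0 -> normalizer A u1 -> forall g0 g1,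
        normalizer A g0 /\ normalizer A g1 /\ A (inv g0 ** g1) ->
        normalizer A (conj g0 u0) /\ normalizer A (conj g1 u1) /\
        A (inv (conj g0 u0) ** conj g1 u1)).
    { intros u0 u1 Hu0 Hu1 g0 g1 (G0 & G1 & Hg).
      splits; [now apply (sgJ _ HN)|now apply (sgJ _ HN)|].
      replace (inv (conj g0 u0) ** conj g1 u1) with
        (conj ((inv g0 ** (u0 ** inv u1)) ** (inv (inv g0) ** inv (u0 ** inv u1))) u0
         ** conj (inv g0 ** g1) u1) by grp.
      apply (sgM _ HA); [|now apply normalizer_conj].
      apply normalizer_conj; [exact Hu0|].
      apply (exponent2_comm A (normalizer A)); auto; sgp HN. }
    assert (Hk : normalizer A (inv x0 ** x1)) by sgp HN.
    splits; [now apply K|apply K; now apply (sgV _ HN)|exact Hk|sgp HN|].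
    replace (inv (inv x0 ** x1) ** (inv x1 ** x0))
      with (inv ((inv x0 ** x1) ** (inv x0 ** x1))) by grp.
    apply (sgV _ HA). auto.
Qed.

Lemma AutT_subgroup (i : nat) : subgroup (AutT i).
Proof. destruct i as [|i]; [apply Grig_subgroup|apply subgroup_normalizer]. Qed.

Lemma AutT_S (i : nat) (x : W) : AutT i x -> AutT (S i) x.
Proof. apply normalizer_incl, AutT_subgroup. Qed.

Lemma AutT_le (i j : nat) (x : W) : i <= j -> AutT i x -> AutT j x.
Proof. intros Hij Hx. induction Hij as [|j Hij IH]; [exact Hx|now apply AutT_S]. Qed.

Lemma Grig_AutT (i : nat) (x : W) : Grig x -> AutT i x.
Proof. apply (AutT_le 0). lia. Qed.

Lemma AutT_levels (i : nat) :
  ((forall j, 1 <= j -> i = 2 * j + 1 -> described (AutT i)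
      (fun x0 x1 => AutT (S j) x0 /\ AutT (S j) x1 /\ AutT j (inv x0 ** x1))) /\
   (forall j, 1 <= j -> i = 2 * j + 2 -> described (AutT i)
      (fun x0 x1 => AutT (S j) x0 /\ AutT (S j) x1))) /\
  (forall x, AutT (S i) x -> AutT i (x ** x)).
Proof.
  set (odd := fun i => forall j, 1 <= j -> i = 2 * j + 1 -> described (AutT i)
      (fun x0 x1 => AutT (S j) x0 /\ AutT (S j) x1 /\ AutT j (inv x0 ** x1))).
  set (even := fun i => forall j, 1 <= j -> i = 2 * j + 2 -> described (AutT i)
      (fun x0 x1 => AutT (S j) x0 /\ AutT (S j) x1)).
  set (exp := fun i => forall x, AutT (S i) x -> AutT i (x ** x)).
  (* Two consecutive levels are carried, since squares from level i + 1 are tested at level i; for i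
     > 2 this reduces [exp] at i to [exp] at about half of i. *)
  enough (H : (odd i /\ even i) /\ (odd (S i) /\ even (S i)) /\ exp i)
    by (split; [apply H|apply H]).
  induction (lt_wf i) as [i _ IH].
  assert (Hi : odd i /\ even i).
  { destruct i as [|i]; [split; intros j; lia|]. apply (IH i). lia. }
  assert (HSi : odd (S i) /\ even (S i)).
  { destruct Hi as [Ho He]. split; intros j Hj Ei.
    - destruct j as [|[|j]]; [lia| |].
      + injection Ei as ->. exact N3_described.
      + apply (normalizer_wreath (AutT (S (S j)))).
        * apply AutT_subgroup.
        * apply AutT_subgroup.
        * apply Grig_AutT, Grig_ga.
        * apply (He (S j)); lia.
    - apply (normalizer_twisted (AutT j)).
      + apply AutT_subgroup.
      + apply AutT_subgroup.
      + apply Grig_AutT, Grig_ga.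
      + apply (IH j). lia.
      + apply Ho; lia. }
  split; [exact Hi|]. split; [exact HSi|].
  destruct Hi as [Ho He], HSi as [HSo HSe]. intros x.
  destruct (le_lt_dec i 2) as [Hi2|Hi2].
  { destruct i as [|[|[|i]]]; [apply N1_exponent2|apply N2_exponent2|apply N3_exponent2|lia]. }
  destruct (Nat.Even_or_Odd i) as [[j Ej]|[j Ej]].
  - destruct j as [|j]; [lia|].
    rewrite (HSo (S j) ltac:(lia) ltac:(lia) x).
    rewrite (He j ltac:(lia) ltac:(lia) (x ** x)), !sec_square; cbn [negb].
    generalize (sec x false) (sec x true). intros x0 x1 (H0 & H1 & Hk).
    assert (Hj : exp (S j)) by (apply (IH (S j)); lia).
    apply Hj in H0. apply Hj in H1. assert (HS := AutT_subgroup (S j)).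
    destruct (x []); split; auto.
    + replace (x0 ** x1) with ((x0 ** x0) ** (inv x0 ** x1)) by grp. now apply (sgM _ HS).
    + replace (x1 ** x0) with ((x1 ** x1) ** inv (inv x0 ** x1)) by grp.
      apply (sgM _ HS); [|apply (sgV _ HS)]; assumption.
  - rewrite (HSe j ltac:(lia) ltac:(lia) x).
    rewrite (Ho j ltac:(lia) ltac:(lia) (x ** x)), !sec_square; cbn [negb].
    generalize (sec x false) (sec x true). intros x0 x1 [H0 H1].
    assert (Hj : exp j) by (apply (IH j); lia).
    assert (HS := AutT_subgroup (S j)). assert (HSj := AutT_subgroup j).
    destruct (x []); splits; try (apply (sgM _ HS); assumption).
    + replace (inv (x0 ** x1) ** (x1 ** x0))
        with ((inv x1 ** inv x0) ** (inv (inv x1) ** inv (inv x0))) by grp.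
      apply (exponent2_comm (AutT j) (AutT (S j))); auto; now apply (sgV _ HS).
    + apply (sgM _ HSj); [apply (sgV _ HSj)|]; auto.
Qed.

Lemma AutT_odd (j : nat) : 1 <= j -> described (AutT (2 * j + 1))
  (fun x0 x1 => AutT (S j) x0 /\ AutT (S j) x1 /\ AutT j (inv x0 ** x1)).
Proof. intros Hj. now apply AutT_levels. Qed.

Lemma AutT_even (j : nat) : 1 <= j -> described (AutT (2 * j + 2))
  (fun x0 x1 => AutT (S j) x0 /\ AutT (S j) x1).
Proof. intros Hj. now apply AutT_levels. Qed.

Lemma AutT_exponent2 (i : nat) (x : W) : AutT (S i) x -> AutT i (x ** x).
Proof. apply AutT_levels. Qed.

(** * Generators *)

Definition tower_gens (i : nat) (y : W) : Prop :=
  is_gen_abcd y \/ exists o, rank o <= i /\ y = om_eval o.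

Lemma rank_pos (o : om) : 1 <= rank o.
Proof. induction o; cbn; lia. Qed.

Definition om_Dp (k : nat) : om := Nat.iter k ODelta OP.

Lemma om_Dp_spec (k : nat) : rank (om_Dp k) = 1 /\ om_eval (om_Dp k) = Dp k.
Proof.
  induction k as [|k [IH1 IH2]]; [split; reflexivity|].
  change (om_Dp (S k)) with (ODelta (om_Dp k)). cbn [rank om_eval].
  rewrite IH1, IH2. split; reflexivity.
Qed.

Lemma rank_one (o : om) : rank o = 1 -> exists k, om_eval o = Dp k.
Proof.
  induction o as [| | |o IH|o IH]; cbn; intros Ho; try lia; try discriminate.
  - now exists 0.
  - destruct IH as [k Hk]; [lia|]. exists (S k). now rewrite Hk.
Qed.

Lemma AutT_Delta (j : nat) (x : W) : 1 <= j -> AutT (S j) x -> AutT (2 * j + 1) (Delta x).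
Proof.
  intros Hj Hx. apply AutT_odd; [exact Hj|]. rewrite !sec_Delta, mulVl.
  split; [exact Hx|]. split; [exact Hx|]. apply (sg1 _ (AutT_subgroup j)).
Qed.

Lemma AutT_Pi (j : nat) (x : W) : 1 <= j -> AutT (S j) x -> AutT (2 * j + 2) (Pi x).
Proof.
  intros Hj Hx. apply AutT_even; [exact Hj|]. rewrite sec_Pi0, sec_Pi1.
  split; [|exact Hx]. apply (sg1 _ (AutT_subgroup (S j))).
Qed.

Lemma chi_Dp (k : nat) : chi (Dp k) = false.
Proof. unfold chi. now rewrite Dp_nil, del_Dp. Qed.

Lemma N2_Pi (x : W) : N1 x -> chi x = false -> N2 (Pi x).
Proof.
  intros Hx Cx. apply N2_described. rewrite sec_Pi0, sec_Pi1, Cx.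
  split; [apply (sg1 _ N1_subgroup)|]. split; [exact Hx|reflexivity].
Qed.

(** Delta and Pi carry level j + 1 to levels 2j + 1 and 2j + 2, which is the rule for ranks. This
    starts at j = 1, so arguments of rank one, which are the [Dp k], are treated apart. *)
Lemma AutT_om (o : om) : AutT (rank o) (om_eval o).
Proof.
  induction o as [| | |o IH|o IH]; cbn [rank om_eval].
  - exact (N1_Dp 0).
  - apply N2_Pi; [|reflexivity].
    apply Grig_N1, gen_mul; [apply Grig_ga|apply Grig_gd].
  - apply N3_described. unfold r_el. rewrite sec_Pi0, sec_Pi1.
    split; [|split]; [apply (Grig_AutT 2), gen_one|apply (Grig_AutT 2), Grig_ga|].
    apply (Grig_AutT 1), gen_mul; [apply gen_inv, gen_one|apply Grig_ga].
  - assert (Hr := rank_pos o). destruct (rank o) as [|[|r]] eqn:Er; [lia| |].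
    + destruct (rank_one o Er) as [k ->]. exact (N1_Dp (S k)).
    + replace (2 * S (S r) - 1) with (2 * S r + 1) by lia. apply AutT_Delta; [lia|exact IH].
  - assert (Hr := rank_pos o). destruct (rank o) as [|[|r]] eqn:Er; [lia| |].
    + destruct (rank_one o Er) as [k Ek]. apply N2_Pi; [exact IH|]. rewrite Ek. apply chi_Dp.
    + replace (2 * S (S r)) with (2 * S r + 2) by lia. apply AutT_Pi; [lia|exact IH].
Qed.

Lemma tower_gens_AutT (i : nat) (x : W) : gen (tower_gens i) x -> AutT i x.
Proof.
  apply gen_sub; [apply AutT_subgroup|]. intros y [Hy|(o & Ho & ->)].
  - now apply Grig_AutT, gen_base.
  - apply (AutT_le (rank o)); [exact Ho|apply AutT_om].
Qed.

Lemma tower_gens_Grig (i : nat) (x : W) : Grig x -> gen (tower_gens i) x.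
Proof. apply gen_mono. intros y Hy. apply gen_base. now left. Qed.

Lemma tower_gens_om (i : nat) (o : om) : rank o <= i -> gen (tower_gens i) (om_eval o).
Proof. intros Ho. apply gen_base. right. now exists o. Qed.

Lemma tower_gens_Dp (i k : nat) : 1 <= i -> gen (tower_gens i) (Dp k).
Proof.
  intros Hi. destruct (om_Dp_spec k) as [Hr <-]. apply tower_gens_om. now rewrite Hr.
Qed.

Lemma Delta_Pi (x : W) : Delta x = Pi x ** conj (Pi x) ga.
Proof. apply W_ext; [reflexivity|secs; grp|secs; grp]. Qed.

(** A splitting fitted to the level descriptions: Delta carries the section at 0 and Pi the
    ratio. *)
Lemma Delta_Pi_decomposition (x : W) :
  x = Delta (sec x false) ** Pi (inv (sec x false) ** sec x true)
      ** (if x [] then ga else one).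
Proof. apply W_ext; destruct (x []) eqn:Ax; secs; rewrite ?Ax; grp. Qed.

(** Pi a is r, Pi b is d, and Pi d comes from r and q; the bound 3 is the rank of r. *)
Lemma tower_gens_Pi_abcd (m : nat) (x : W) : 3 <= m -> is_gen_abcd x ->
  gen (tower_gens m) (Pi x).
Proof.
  intros Hm Hx.
  assert (Pa : gen (tower_gens m) (Pi ga)) by (apply (tower_gens_om m OR); exact Hm).
  assert (Pb : gen (tower_gens m) (Pi gb)).
  { replace (Pi gb) with gd by now apply W_ext. apply tower_gens_Grig, Grig_gd. }
  assert (Pd : gen (tower_gens m) (Pi gd)).
  { replace gd with (inv ga ** (ga ** gd)) by grp. rewrite Pi_mul, Pi_inv.
    apply gen_mul; [now apply gen_inv|]. apply (tower_gens_om m OQ). cbn. lia. }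
  destruct Hx as [->|[->|[->| ->]]]; auto.
  replace gc with (gb ** gd) by (apply (bcd_mul Bb Bd); discriminate).
  rewrite Pi_mul. now apply gen_mul.
Qed.

Lemma tower_gens_Pi (j m : nat) (x : W) : 2 * j <= m -> 3 <= m ->
  gen (tower_gens j) x -> gen (tower_gens m) (Pi x).
Proof.
  intros Hj Hm. revert x.
  apply (gen_sub _ (fun x => gen (tower_gens m) (Pi x)));
    [apply (subgroup_Pi _ (subgroup_gen _))|].
  intros y [Hy|(o & Ho & ->)]; [now apply tower_gens_Pi_abcd|].
  apply (tower_gens_om m (OPi o)). cbn. lia.
Qed.

Lemma tower_gens_Delta (j m : nat) (x : W) : 2 * j - 1 <= m -> 3 <= m ->
  gen (tower_gens j) x -> gen (tower_gens m) (Delta x).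
Proof.
  intros Hj Hm. revert x.
  apply (gen_sub _ (fun x => gen (tower_gens m) (Delta x)));
    [apply (subgroup_Delta _ (subgroup_gen _))|].
  intros y [Hy|(o & Ho & ->)].
  - assert (H := tower_gens_Pi_abcd m y Hm Hy). rewrite Delta_Pi.
    apply gen_mul; [exact H|]. apply (sgJ _ (subgroup_gen _)); [exact H|].
    apply tower_gens_Grig, Grig_ga.
  - apply (tower_gens_om m (ODelta o)). cbn [rank]. lia.
Qed.

Lemma tower_gens_decompose (m : nat) (x : W) :
  gen (tower_gens m) (Delta (sec x false)) ->
  gen (tower_gens m) (Pi (inv (sec x false) ** sec x true)) -> gen (tower_gens m) x.
Proof.
  intros H0 H1. rewrite (Delta_Pi_decomposition x).
  apply gen_mul; [now apply gen_mul|].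
  apply tower_gens_Grig. destruct (x []); [apply Grig_ga|apply gen_one].
Qed.

(** Descent through D8: q = Pi(ad) reduces the kernel of [chi] to the centre, and p reduces the
    centre to the kernel of [phi], where [Grig_Pi_ker] applies. *)
Lemma tower_gens_2_Pi_Grig (g : W) : Grig g -> chi g = false -> gen (tower_gens 2) (Pi g).
Proof.
  assert (K0 : forall g, Grig g -> phi g = dunit -> gen (tower_gens 2) (Pi g))
    by (intros h Hh Ph; now apply tower_gens_Grig, Grig_Pi_ker).
  assert (K1 : forall g, Grig g -> g [] = false -> del g = false ->
    gen (tower_gens 2) (Pi g)).
  { intros h Hh Ah Dh. destruct (kap h) eqn:Kh.
    - replace h with (Delta gb ** (inv (Delta gb) ** h)) by grp. rewrite Pi_mul.
      apply gen_mul; [rewrite <- p_el_adad; apply (tower_gens_om 2 OP); cbn; lia|].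
      apply K0; [apply gen_mul; [apply gen_inv, Grig_Delta_gb|exact Hh]|].
      rewrite phi_mul, phi_inv. change (phi h) with (h [], del h, kap h).
      now rewrite Ah, Dh, Kh.
    - apply K0; [exact Hh|]. change (phi h) with (h [], del h, kap h).
      now rewrite Ah, Dh, Kh. }
  intros Hg Cg. unfold chi in Cg. destruct (g []) eqn:Ag, (del g) eqn:Dg;
    try discriminate; [|now apply K1].
  replace g with ((ga ** gd) ** (inv (ga ** gd) ** g)) by grp. rewrite Pi_mul.
  apply gen_mul; [apply (tower_gens_om 2 OQ); cbn; lia|]. apply K1.
  - apply gen_mul; [apply gen_inv, gen_mul; [apply Grig_ga|apply Grig_gd]|exact Hg].
  - now rewrite mul_nil, Ag.
  - now rewrite del_mul, Dg.
Qed.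

Lemma Dps_tower_gens (s : W) : Dps s ->
  gen (tower_gens 2) (Delta s) /\ gen (tower_gens 2) (Pi s).
Proof.
  intros Hs. split; revert s Hs.
  - apply (gen_sub _ (fun x => gen (tower_gens 2) (Delta x)));
      [apply (subgroup_Delta _ (subgroup_gen _))|].
    intros y [k ->]. apply (tower_gens_Dp 2 (S k)). lia.
  - apply (gen_sub _ (fun x => gen (tower_gens 2) (Pi x)));
      [apply (subgroup_Pi _ (subgroup_gen _))|].
    intros y [k ->]. destruct (om_Dp_spec k) as [Hr <-].
    apply (tower_gens_om 2 (OPi (om_Dp k))). cbn [rank]. lia.
Qed.

Lemma tower_gens_2_Pi (x : W) : N1 x -> chi x = false -> gen (tower_gens 2) (Pi x).
Proof.
  intros (s & g & Hs & Hg & ->)%N1_N1gen%N1gen_decomposition.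
  destruct (Dps_bits s Hs) as [As Ds]. rewrite chi_mul. unfold chi at 1.
  rewrite As, Ds, Pi_mul. intros Cg.
  apply gen_mul; [now apply Dps_tower_gens|]. apply tower_gens_2_Pi_Grig; auto.
Qed.

Lemma tower_gens_2_Delta (x : W) : N1 x -> gen (tower_gens 2) (Delta x).
Proof.
  intros (s & g & Hs & Hg & ->)%N1_N1gen%N1gen_decomposition. rewrite Delta_mul.
  apply gen_mul; [now apply Dps_tower_gens|].
  (* Delta g is compared with an element y of G having section g at 0; the two sections of y have
     the same [chi], as [dswap] preserves it. *)
  destruct (Grig_lift g Hg) as (y & Hy & Ay & Ey).
  destruct (Grig_sections y Hy) as (_ & Hy1 & Py). rewrite Ey in Py.
  replace (Delta g) with (y ** Pi (inv (sec y true) ** g)).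
  - apply gen_mul; [now apply tower_gens_Grig|]. apply tower_gens_2_Pi_Grig.
    + apply gen_mul; [now apply gen_inv|exact Hg].
    + rewrite chi_mul, chi_inv. unfold chi. unfold phi in Py. injection Py as P1 P2 _.
      rewrite P1, P2, (xorb_comm (del g)). apply xorb_nilpotent.
  - apply W_ext; secs; rewrite ?Ay; secs; rewrite ?Ey; grp.
Qed.

Lemma AutT_tower_gens (i : nat) (x : W) : AutT i x <-> gen (tower_gens i) x.
Proof.
  split; [|apply tower_gens_AutT]. revert x.
  induction (lt_wf i) as [i _ IH]. intros x.
  destruct i as [|[|[|i]]].
  - apply tower_gens_Grig.
  - intros Hx%N1_N1gen. revert x Hx. apply gen_mono. intros y [Hy|[k ->]].
    + apply gen_base. now left.
    + now apply tower_gens_Dp.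
  - intros (H0 & H1 & Hchi)%N2_described. apply tower_gens_decompose.
    + now apply tower_gens_2_Delta.
    + apply tower_gens_2_Pi; [sgp N1_subgroup|].
      rewrite chi_mul, chi_inv, Hchi. apply xorb_nilpotent.
  - destruct (Nat.Even_or_Odd i) as [[j Ej]|[j Ej]].
    + replace (S (S (S i))) with (2 * S j + 1) by lia.
      intros (H0 & H1 & Hk)%AutT_odd; [|lia]. apply tower_gens_decompose.
      * apply (tower_gens_Delta (S (S j))); [lia..|]. apply IH; [lia|exact H0].
      * apply (tower_gens_Pi (S j)); [lia..|]. apply IH; [lia|exact Hk].
    + replace (S (S (S i))) with (2 * S j + 2) by lia.
      intros (H0 & H1)%AutT_even; [|lia]. apply tower_gens_decompose.
      * apply (tower_gens_Delta (S (S j))); [lia..|]. apply IH; [lia|exact H0].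
      * apply (tower_gens_Pi (S (S j))); [lia..|]. apply IH; [lia|].
        assert (HS := AutT_subgroup (S (S j))). sgp HS.
Qed.

Lemma AutT_star (n : nat) (v : vert) (g : W) :
  1 <= n -> length v = n -> Grig g -> AutT (3 * 2 ^ (n - 1)) (star v g).
Proof.
  intros Hn Hv Hg. revert v Hv. induction Hn as [|n Hn IH]; intros v Hv.
  - destruct v as [|b [|]]; try discriminate. apply N3_described.
    assert (H2 : N2 one /\ N2 g) by (split; apply (Grig_AutT 2); [apply gen_one|exact Hg]).
    destruct b; [change (N2 one /\ N2 g /\ N1 (inv one ** g))|
                 change (N2 g /\ N2 one /\ N1 (inv g ** one))];
      splits; try tauto; apply Grig_N1, gen_mul; auto using gen_inv, gen_one.
  - destruct v as [|b v]; [discriminate|]. injection Hv as Hv. specialize (IH v Hv).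
    assert (Hpos := Nat.pow_nonzero 2 (n - 1) ltac:(lia)).
    (* The previous level is m + 2; its double 2(m + 1) + 2 is even, where the two sections are
       independent. *)
    destruct (3 * 2 ^ (n - 1)) as [|[|m]] eqn:Em; [lia..|].
    replace (3 * 2 ^ (S n - 1)) with (2 * S m + 2).
    + apply AutT_even; [lia|].
      assert (H1 : AutT (S (S m)) one) by apply (sg1 _ (AutT_subgroup _)).
      destruct b; split; assumption.
    + replace (S n - 1) with (S (n - 1)) by lia. cbn [Nat.pow]. lia.
Qed.

(** * Cardinality of the quotients *)

Definition enumerated (P : W -> Prop) : Prop :=
  exists f : nat -> W, (forall n, P (f n)) /\ forall x, P x -> exists n, f n = x.

(** A code n stands for an expression, tagged 0 for a generator, 1 for a product, 2 for an inverse;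
    k bounds its depth, and [one] is the default. *)
Fixpoint decode (f : nat -> W) (k n : nat) : W :=
  match k with
  | 0 => one
  | S k =>
      let (t, m) := Cantor.of_nat n in
      match t with
      | 0 => f m
      | 1 => let (u, v) := Cantor.of_nat m in decode f k u ** decode f k v
      | 2 => inv (decode f k m)
      | _ => one
      end
  end.

Lemma enumerated_gen (S : W -> Prop) : enumerated S -> enumerated (gen S).
Proof.
  intros (f & HfS & Hf).
  exists (fun n => let (k, m) := Cantor.of_nat n in decode f k m). split.
  - intros n. destruct (Cantor.of_nat n) as [k m]. clear n. revert m.
    induction k as [|k IH]; intros m; [apply gen_one|]. cbn [decode].
    destruct (Cantor.of_nat m) as [t l]. destruct t as [|[|[|t]]].
    + apply gen_base, HfS.
    + destruct (Cantor.of_nat l) as [u v]. apply gen_mul; apply IH.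
    + apply gen_inv, IH.
    + apply gen_one.
  - intros x Hx.
    (* A threshold instead of a single depth lets both factors of a product be decoded at a common
       depth. *)
    assert (exists k0, forall k, k0 <= k -> exists n, decode f k n = x) as [k Hk].
    { induction Hx as [x Hx| |x y _ [k Hk] _ [l Hl]|x _ [k Hk]].
      - destruct (Hf x Hx) as [m <-]. exists 1. intros [|k] Hk; [lia|].
        exists (Cantor.to_nat (0, m)). cbn [decode]. now rewrite Cantor.cancel_of_to.
      - exists 0. intros [|k] _; [now exists 0|].
        exists (Cantor.to_nat (3, 0)). cbn [decode]. now rewrite Cantor.cancel_of_to.
      - exists (1 + k + l). intros [|m] Hm; [lia|].
        destruct (Hk m ltac:(lia)) as [u <-], (Hl m ltac:(lia)) as [v <-].
        exists (Cantor.to_nat (1, Cantor.to_nat (u, v))). cbn [decode]. now rewrite !Cantor.cancel_of_to.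
      - exists (1 + k). intros [|m] Hm; [lia|].
        destruct (Hk m ltac:(lia)) as [u <-].
        exists (Cantor.to_nat (2, u)). cbn [decode]. now rewrite Cantor.cancel_of_to. }
    destruct (Hk k (le_n k)) as [n <-]. exists (Cantor.to_nat (k, n)).
    now rewrite Cantor.cancel_of_to.
Qed.

Fixpoint om_decode (k n : nat) : om :=
  match k with
  | 0 => OP
  | S k =>
      let (t, m) := Cantor.of_nat n in
      match t with
      | 0 => OP | 1 => OQ | 2 => OR
      | 3 => ODelta (om_decode k m)
      | _ => OPi (om_decode k m)
      end
  end.

Lemma om_decode_surj (o : om) : exists k n, om_decode k n = o.
Proof.
  induction o as [| | |o (k & n & <-)|o (k & n & <-)].
  - now exists 0, 0.
  - exists 1, (Cantor.to_nat (1, 0)). cbn [om_decode]. now rewrite Cantor.cancel_of_to.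
  - exists 1, (Cantor.to_nat (2, 0)). cbn [om_decode]. now rewrite Cantor.cancel_of_to.
  - exists (S k), (Cantor.to_nat (3, n)). cbn [om_decode]. now rewrite Cantor.cancel_of_to.
  - exists (S k), (Cantor.to_nat (4, n)). cbn [om_decode]. now rewrite Cantor.cancel_of_to.
Qed.

Lemma enumerated_tower_gens (i : nat) : enumerated (tower_gens i).
Proof.
  exists (fun n => match n with
    | 0 => ga | 1 => gb | 2 => gc | 3 => gd
    | S (S (S (S n))) =>
        let (k, m) := Cantor.of_nat n in
        let o := om_decode k m in if rank o <=? i then om_eval o else ga
    end).
  split.
  - intros [|[|[|[|n]]]]; try (left; unfold is_gen_abcd; tauto).
    destruct (Cantor.of_nat n) as [k m]. cbv zeta. destruct (Nat.leb_spec (rank (om_decode k m)) i) as [H|H].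
    + right. now exists (om_decode k m).
    + left. now left.
  - intros x [[->|[->|[->| ->]]]|(o & Ho & ->)];
      [now exists 0|now exists 1|now exists 2|now exists 3|].
    destruct (om_decode_surj o) as (k & m & <-). exists (4 + Cantor.to_nat (k, m)).
    cbn [Nat.add]. rewrite Cantor.cancel_of_to. apply Nat.leb_le in Ho. now rewrite Ho.
Qed.

Lemma Grig_p_el : ~ Grig p_el.
Proof.
  rewrite p_el_adad. intros (_ & _ & H)%Grig_sections. vm_compute in H. discriminate.
Qed.

Lemma Grig_Dp (k : nat) : ~ Grig (Dp k).
Proof.
  induction k as [|k IH]; [apply Grig_p_el|]. intros (H & _)%Grig_sections. exact (IH H).
Qed.

(** Sections at 0 strip Delta from both factors, and p has trivial section there; unequal indices
    would thus put some [Dp k] in G. *)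
Lemma Dp_independent (m n : nat) : Grig (Dp m ** inv (Dp n)) -> m = n.
Proof.
  revert n. induction m as [|m IH]; intros [|n] H;
    [reflexivity|exfalso|exfalso|f_equal]; apply Grig_sections, proj1 in H.
  - change (Grig (one ** inv (Dp n))) in H. rewrite mul1 in H.
    apply (Grig_Dp n). rewrite <- (inv_inv (Dp n)). now apply gen_inv.
  - change (Grig (Dp m ** inv one)) in H. rewrite inv_one, mulr1 in H.
    exact (Grig_Dp m H).
  - apply IH. exact H.
Qed.

(** The families [Dp n] and [Pi (Dp n)] serve levels 1 and 2; Delta then transports a family to an
    odd level, and Pi to an even one, from about half the level. *)
Lemma AutT_infinite_index (i : nat) : exists f : nat -> W,
  (forall n, AutT (S i) (f n)) /\
  forall n m, n <> m -> ~ AutT i (f n ** inv (f m)).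
Proof.
  induction (lt_wf i) as [i _ IH]. destruct i as [|[|i]].
  - exists Dp. split; [exact N1_Dp|]. intros n m Hnm H. now apply Hnm, Dp_independent.
  - exists (fun n => Pi (Dp n)). split.
    + intros n. apply N2_Pi; [apply N1_Dp|apply chi_Dp].
    + intros n m Hnm (_ & _ & H & _)%N1_described. apply Hnm, Dp_independent.
      rewrite <- Pi_inv, <- Pi_mul in H.
      now rewrite sec_Pi0, sec_Pi1, inv_one, mul1 in H.
  - destruct (Nat.Even_or_Odd i) as [[j Ej]|[j Ej]].
    + destruct (IH (S j) ltac:(lia)) as (f & Hf & Hff). exists (fun n => Delta (f n)).
      split.
      * intros n. replace (S (S (S i))) with (2 * S j + 1) by lia.
        apply AutT_Delta; [lia|apply Hf].
      * intros n m Hnm. rewrite <- Delta_inv, <- Delta_mul. intros H.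
        apply (Hff n m Hnm). destruct j as [|j].
        -- replace i with 0 in H by lia. now apply N2_described in H.
        -- replace (S (S i)) with (2 * S j + 2) in H by lia.
           apply AutT_even in H; [apply H|lia].
    + destruct (IH (S j) ltac:(lia)) as (f & Hf & Hff). exists (fun n => Pi (f n)).
      split.
      * intros n. replace (S (S (S i))) with (2 * S j + 2) by lia.
        apply AutT_Pi; [lia|apply Hf].
      * intros n m Hnm. rewrite <- Pi_inv, <- Pi_mul. intros H.
        apply (Hff n m Hnm). replace (S (S i)) with (2 * S j + 1) in H by lia.
        apply AutT_odd in H; [|lia]. destruct H as (_ & _ & H).
        now rewrite sec_Pi0, sec_Pi1, inv_one, mul1 in H.
Qed.

Lemma AutT_quotient (i : nat) : quotient_is_Z2_omega (AutT i) (AutT (S i)).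
Proof.
  split; [|split; [|split]].
  - apply AutT_exponent2.
  - apply (exponent2_comm _ _ (AutT_subgroup i) (AutT_subgroup (S i)));
      [auto|apply AutT_exponent2].
  - apply AutT_infinite_index.
  - destruct (enumerated_gen _ (enumerated_tower_gens (S i))) as (f & HfS & Hf).
    exists f. split; [intros n; apply AutT_tower_gens, HfS|].
    intros x Hx%AutT_tower_gens. destruct (Hf x Hx) as [n <-]. exists n.
    rewrite mulV. apply (sg1 _ (AutT_subgroup i)).
Qed.

Lemma AutT_S_generated (i : nat) (x : W) : AutT (S i) x <->
  gen (fun y => AutT i y \/ exists o, rank o = S i /\ y = om_eval o) x.
Proof.
  split.
  - rewrite AutT_tower_gens. apply gen_mono. intros y [Hy|(o & Ho & ->)]; apply gen_base.
    + left. now apply Grig_AutT, gen_base.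
    + apply le_lt_eq_dec in Ho as [Ho|Ho]; [|eauto].
      left. apply (AutT_le (rank o)); [lia|apply AutT_om].
  - apply gen_sub; [apply AutT_subgroup|]. intros y [Hy|(o & Ho & ->)].
    + now apply AutT_S.
    + rewrite <- Ho. apply AutT_om.
Qed.

(** * The union of the tower *)

Lemma AutOmega_subgroup : subgroup AutOmega.
Proof.
  split.
  - exists 0. apply gen_one.
  - intros x y [i Hx] [j Hy]. exists (i + j).
    apply (sgM _ (AutT_subgroup (i + j)));
      [apply (AutT_le i)|apply (AutT_le j)]; auto; lia.
  - intros x [i Hx]. exists i. now apply (sgV _ (AutT_subgroup i)).
Qed.

Lemma AutOmega_generated (x : W) :
  AutOmega x <-> gen (fun y => is_gen_abcd y \/ exists o, y = om_eval o) x.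
Proof.
  split.
  - intros [i Hx%AutT_tower_gens]. revert x Hx. apply gen_mono.
    intros y [Hy|(o & _ & ->)]; apply gen_base; eauto.
  - apply gen_sub; [apply AutOmega_subgroup|]. intros y [Hy|[o ->]].
    + exists 0. now apply gen_base.
    + exists (rank o). apply AutT_om.
Qed.

Lemma Gstar_subgroup : subgroup Gstar.
Proof. apply subgroup_gen. Qed.

Lemma Grig_Gstar (x : W) : Grig x -> Gstar x.
Proof. intros Hx. apply gen_base. now exists [], x. Qed.

Lemma Gstar_Pi (x : W) : Gstar x -> Gstar (Pi x).
Proof.
  revert x. apply (gen_sub _ (fun x => Gstar (Pi x)));
    [apply (subgroup_Pi _ Gstar_subgroup)|].
  intros y (v & g & Hg & ->). apply gen_base. exists (true :: v), g.
  split; [exact Hg|]. now apply W_ext.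
Qed.

Lemma Gstar_Delta (x : W) : Gstar x -> Gstar (Delta x).
Proof.
  intros Hx%Gstar_Pi. rewrite Delta_Pi. apply gen_mul; [exact Hx|].
  apply (sgJ _ Gstar_subgroup); [exact Hx|apply Grig_Gstar, Grig_ga].
Qed.

Lemma Gstar_described : described Gstar (fun g0 g1 => Gstar g0 /\ Gstar g1).
Proof.
  intros x. split.
  - intros Hx. induction Hx as [x (v & g & Hg & ->)| |x y _ [X0 X1] _ [Y0 Y1]|x _ [X0 X1]].
    + destruct v as [|b v].
      * apply Grig_sections in Hg. split; apply Grig_Gstar, Hg.
      * assert (H1 : Gstar one) by apply gen_one.
        assert (Hs : Gstar (star v g)) by (apply gen_base; eauto).
        destruct b; split; assumption.
    + split; apply gen_one.
    + rewrite !sec_mul. destruct (x []); split; now apply gen_mul.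
    + rewrite !sec_inv. destruct (x []); split; now apply gen_inv.
  - intros [H0 H1]. rewrite (Delta_Pi_decomposition x). apply gen_mul; [apply gen_mul|].
    + now apply Gstar_Delta.
    + apply Gstar_Pi. sgp Gstar_subgroup.
    + destruct (x []); [apply Grig_Gstar, Grig_ga|apply gen_one].
Qed.

Lemma AutOmega_Gstar (x : W) : AutOmega x <-> Gstar x.
Proof.
  split.
  - rewrite AutOmega_generated. apply gen_sub; [apply Gstar_subgroup|].
    intros y [Hy|[o ->]]; [now apply Grig_Gstar, gen_base|].
    induction o as [| | |o IH|o IH]; cbn [om_eval].
    + unfold p_el. apply Gstar_Pi, Grig_Gstar.
      repeat first [apply Grig_ga|apply Grig_gd|apply gen_mul].
    + unfold q_el. apply Gstar_Pi, Grig_Gstar.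
      repeat first [apply Grig_ga|apply Grig_gd|apply gen_mul].
    + apply Gstar_Pi, Grig_Gstar, Grig_ga.
    + now apply Gstar_Delta.
    + now apply Gstar_Pi.
  - apply gen_sub; [apply AutOmega_subgroup|]. intros y (v & g & Hg & ->).
    destruct v as [|b v]; [now exists 0|].
    exists (3 * 2 ^ (length (b :: v) - 1)). apply AutT_star; [cbn; lia|reflexivity|exact Hg].
Qed.

Lemma normalizer_ext (A B : W -> Prop) : (forall x, A x <-> B x) ->
  forall x, normalizer A x <-> normalizer B x.
Proof.
  intros HAB x. rewrite !normalizerE. split; intros [H1 H2]; split; intros h Hh;
    apply HAB; (apply H1 || apply H2); now apply HAB.
Qed.

(** A section far along the spine lies in G. The ratio of a normalizing element lies in [Gstar], so
    each step back up recovers the section at 0 from the one at 1. *)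
Lemma normalizer_Gstar (x : W) : normalizer Gstar x <-> Gstar x.
Proof.
  split; [|apply normalizer_incl, Gstar_subgroup]. intros Hx.
  assert (HD := normalizer_wreath Gstar Gstar Gstar_subgroup Gstar_subgroup
    (Grig_Gstar _ Grig_ga) Gstar_described).
  assert (HS : forall n, normalizer Gstar (spine n x)).
  { intros n. revert x Hx. induction n as [|n IH]; [auto|]. intros x Hx.
    apply IH. now apply HD in Hx. }
  destruct (spine_terminates x) as [n Hn%Grig_Gstar].
  - intros i. apply contracting_Gstar, (normalizer_conj Gstar); [exact Hx|].
    apply Grig_Gstar, Grig_bcd.
  - intros n. apply contracting_Gstar. now apply HD.
  - clear HS. revert x Hx Hn. induction n as [|n IH]; [auto|]. intros x Hx Hn.
    apply HD in Hx as (_ & H1 & Hk).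
    assert (G1 : Gstar (sec x true)) by now apply IH.
    apply Gstar_described. split; [|exact G1].
    replace (sec x false) with (sec x true ** inv (inv (sec x false) ** sec x true)) by grp.
    sgp Gstar_subgroup.
Qed.

Theorem theorem6p1 :
  (* Aut^i(G) = < a, b, c, d, w ∈ Ω with rank w <= i > *)
  (forall (i : nat) (x : W),
      AutT i x <->
      gen (fun y => is_gen_abcd y \/ exists o, rank o <= i /\ y = om_eval o) x) /\
  (* Aut^(3·2^(n-1))(G) contains v*G for all v ∈ X^n *)
  (forall (n : nat) (v : vert) (g : W),
      1 <= n -> length v = n -> Grig g -> AutT (3 * 2 ^ (n - 1)) (star v g)) /\
  (* Out(Aut^i(G)) = Aut^(i+1)(G)/Aut^i(G) ≅ (Z/2)^omega, generated by the
     elements of Ω of rank i+1 *)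
  (forall i : nat,
      quotient_is_Z2_omega (AutT i) (AutT (S i)) /\
      (forall x, AutT (S i) x <->
         gen (fun y => AutT i y \/ exists o, rank o = S i /\ y = om_eval o) x)) /\
  (* Aut^omega(G) = < G, Ω > = G_* *)
  (forall x : W,
      AutOmega x <-> gen (fun y => is_gen_abcd y \/ exists o, y = om_eval o) x) /\
  (forall x : W, AutOmega x <-> Gstar x) /\
  (* the tower is stationary from omega on: Aut^(omega+1)(G) = Aut^omega(G) *)
  (forall x : W, normalizer AutOmega x <-> AutOmega x).
Proof.
  split; [exact AutT_tower_gens|]. split; [exact AutT_star|].
  split; [intros i; split; [apply AutT_quotient|apply AutT_S_generated]|].
  split; [exact AutOmega_generated|]. split; [exact AutOmega_Gstar|].
  intros x. rewrite (normalizer_ext _ _ AutOmega_Gstar x), AutOmega_Gstar.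
  apply normalizer_Gstar.
Qed.
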